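(* Let $C_n$ be a projective primitive multiple curve of multiplicity $n>1$ with associated reduced curve $C$, and let $\mathcal{E}$ be a coherent sheaf on $C_n$. Then $\mathcal{E}$ is quasi locally free if and only if all the terms $\mathcal{I}_C^{i-1}\mathcal{E}/\mathcal{I}_C^{i}\mathcal{E}$ ($1\leq i\leq n$) of $\mathrm{Gr}(\mathcal{E})$ are locally free sheaves on $C$.
   Context: Everything is over $\mathbb{C}$. Primitive multiple curves: let $X$ be a smooth connected threefold and $C\subset X$ a smooth irreducible projective curve. A primitive multiple curve with support $C$ is a closed Cohen–Macaulay subscheme $Y\subset X$ with $Y_{red}=C$ such that for every closed point $P\in C$ there is a surface in $X$, smooth at $P$, containing a neighbourhood of $P$ in $Y$. Its multiplicity is the smallest $n$ such that $Y$ is contained in the subscheme of $X$ defined by the $n$-th power of the ideal sheaf of $C$ in $X$; write $C_n=Y$. Let $\mathcal{I}_C$ be the ideal sheaf of $C$ in $C_n$ (locally generated by one element $z$, with $z^n=0$), and let $C_i\subset C_n$ be the subscheme with ideal sheaf $\mathcal{I}_C^i$, with structure sheaf $\mathcal{O}_i=\mathcal{O}_{C_i}$, for $1\le i\le n$. For a coherent sheaf $\mathcal{E}$ on $C_n$, $\mathrm{Gr}(\mathcal{E})=\bigoplus_{i=1}^n\mathcal{I}_C^{i-1}\mathcal{E}/\mathcal{I}_C^i\mathcal{E}$, a coherent $\mathcal{O}_C$-module. A finitely generated $\mathcal{O}_{n,P}$-module $M$ ($P\in C$) is quasi free of type $(m_1,\dots,m_n)$ if $M\simeq\bigoplus_{i=1}^n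 m_i\mathcal{O}_{i,P}$, where the $m_i\ge 0$ are integers and $m_i\mathcal{O}_{i,P}$ denotes the direct sum of $m_i$ copies of $\mathcal{O}_{i,P}$. A coherent sheaf $\mathcal{E}$ is quasi locally free at $P$ if there are an open neighbourhood $U$ of $P$ in $C_n$ and integers $m_1,\dots,m_n\geq 0$ such that for every point $Q\in U$ the stalk $\mathcal{E}_Q$ is quasi free of type $(m_1,\dots,m_n)$; it is quasi locally free if it is so at every point of $C_n$. *)

(* Defs.v *)
From HB Require Import structures.
From mathcomp Require Import all_boot all_order all_algebra.
From mathcomp Require Import all_classical reals topology.
From mathcomp Require Import generic_quotient ring_quotient complex.
From mathcomp Require Import mpoly.

Set Implicit Arguments.
Unset Strict Implicit.
Unset Printing Implicit Defensive.

Import GRing.Theory.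
Local Open Scope classical_set_scope.
Local Open Scope ring_scope.
Local Open Scope quotient_scope.

(** * Commutative algebra *)

Definition submodule (A : nzRingType) (M : lmodType A) (N : set M) : Prop :=
  N 0 /\ forall a u v, N u -> N v -> N (a *: u + v).

Definition span (A : nzRingType) (M : lmodType A) (S : set M) : set M :=
  smallest (@submodule A M) S.

(* [smallest P S] is the intersection of the sets containing [S] and satisfying [P].
   Ideals are the submodules of the regular module [A^o]; they may be improper. *)
Definition ideal (A : nzRingType) (I : set A) : Prop := @submodule A A^o I.

Definition ideal_span (A : nzRingType) (S : set A) : set A := @span A A^o S.

Definition ideal_mul (A : nzRingType) (I J : set A) : set A :=
  ideal_span [set a * b | a in I & b in J].

Definition ideal_exp (A : nzRingType) (I : set A) (n : nat) : set A :=
  iter n (ideal_mul I) setT.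

Definition ideal_scale (A : nzRingType) (M : lmodType A) (I : set A) (N : set M)
  : set M := span [set a *: v | a in I & v in N].

Definition radical (A : nzRingType) (I : set A) : set A :=
  [set a | exists m, I (a ^+ m)].

Definition prime_ideal (A : nzRingType) (p : set A) : Prop :=
  [/\ ideal p, ~ p 1 & forall a b, p (a * b) -> p a \/ p b].

(* The rings below are not assumed to be [unitRingType]s, hence a [Prop] notion of unit.
   In a local ring the maximal ideal is the set of non-units. *)
Definition invertible (A : nzRingType) (a : A) : Prop :=
  exists b, a * b = 1 /\ b * a = 1.

Definition nonunits (A : nzRingType) : set A := [set a | ~ invertible a].

Definition local_ring (A : nzRingType) : Prop := ideal (@nonunits A).

Definition noetherian (A : nzRingType) : Prop :=
  forall I : set A, ideal I -> exists s : seq A, I = ideal_span [set` s].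

(* Only [p 0], ..., [p d] matter: a strict chain of length [d]. *)
Definition prime_chain (A : nzRingType) (d : nat) : Prop :=
  exists p : nat -> set A,
    (forall i, (i <= d)%N -> prime_ideal (p i)) /\
    (forall i, (i < d)%N -> p i `<` p i.+1).

Definition krull_dim (A : nzRingType) (d : nat) : Prop :=
  prime_chain A d /\ ~ prime_chain A d.+1.

Definition regular_local (A : nzRingType) (d : nat) : Prop :=
  [/\ local_ring A, noetherian A, krull_dim A d
    & exists s : d.-tuple A, @nonunits A = ideal_span [set` s]].

Definition regular_sequence (A : nzRingType) (s : seq A) : Prop :=
  ~ ideal_span [set` s] 1 /\
  forall i, (i < size s)%N -> forall a,
    ideal_span [set` take i s] (s`_i * a) -> ideal_span [set` take i s] a.

Definition cohen_macaulay_local (A : nzRingType) : Prop :=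
  [/\ local_ring A, noetherian A
    & exists d (s : d.-tuple A),
        [/\ krull_dim A d, {subset s <= @nonunits A} & regular_sequence s]].

Definition fg_algebra (k : fieldType) (A : comAlgType k) : Prop :=
  exists s : seq A, forall S : {pred A},
    GRing.subalg_closed S -> {subset s <= S} -> forall a, a \in S.

(** ** Submodules and quotients as modules *)

Record submod (A : nzRingType) (M : lmodType A) :=
  Submod { submod_set :> M -> Prop; submodP : submodule submod_set }.

Lemma span_submodule (A : nzRingType) (M : lmodType A) (S : set M) :
  submodule (span S).
Proof.
split=> [N [[N0 _] _] //|a u v Su Sv N [Nsub SN]].
by apply: Nsub.2; [apply: Su|apply: Sv].
Qed.

Section SubmodTheory.
Context (A : nzRingType) (M : lmodType A) (N : set M) (NP : submodule N).

Lemma submodule0 : N 0. Proof. by case: NP. Qed.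

Lemma submoduleD u v : N u -> N v -> N (u + v).
Proof. by move=> Nu Nv; rewrite -[u]scale1r; apply: NP.2. Qed.

Lemma submoduleZ a u : N u -> N (a *: u).
Proof. by move=> Nu; rewrite -[_ *: _]addr0; apply: NP.2 => //; exact: submodule0. Qed.

Lemma submoduleN u : N u -> N (- u).
Proof. by rewrite -scaleN1r; exact: submoduleZ. Qed.

Lemma submoduleB u v : N u -> N v -> N (u - v).
Proof. by move=> Nu Nv; apply: submoduleD => //; exact: submoduleN. Qed.

End SubmodTheory.

Section SubmodType.
Context (A : nzRingType) (M : lmodType A) (N : submod M).

Definition submod_pred : pred M := fun v => `[< N v >].

Lemma submod_pred_closed : GRing.submod_closed submod_pred.
Proof.
split=> [|a u v /asboolP Nu /asboolP Nv]; apply/asboolP.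
  exact: submodule0 (submodP N).
by apply: (submodP N).2.
Qed.

HB.instance Definition _ :=
  GRing.isSubmodClosed.Build A M submod_pred (GRing.submod_closed_semi submod_pred_closed).

Definition submod_type : Type := {v : M | submod_pred v}.
HB.instance Definition _ := SubChoice.on submod_type.
HB.instance Definition _ := [SubChoice_isSubLmodule of submod_type by <:].

Definition submod_zpred := GRing.ZmodClosed.clone M submod_pred _.
Definition quomod : Type := (Quotient.quot submod_zpred).
HB.instance Definition _ := GRing.Zmodule.on quomod.

Definition quo_class (v : M) : quomod := \pi_((Quotient.quot submod_zpred)) v.
Definition quo_repr (q : quomod) : M := @repr _ (Quotient.quot submod_zpred) q.

Lemma quo_reprK q : quo_class (quo_repr q) = q. Proof. exact: reprK. Qed.

Lemma quo_classP u v : quo_class u = quo_class v <-> N (u - v).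
Proof.
split=> [/eqP|Nuv].
  by rewrite -Quotient.idealrBE => /asboolP.
by apply/eqP; rewrite -Quotient.idealrBE; apply/asboolP.
Qed.

Lemma quo_classD u v : quo_class (u + v) = quo_class u + quo_class v.
Proof. exact: (@Quotient.pi_add _ submod_zpred). Qed.

Definition quo_scale (a : A) (q : quomod) : quomod := quo_class (a *: quo_repr q).

Lemma quo_classZ a v : quo_class (a *: v) = quo_scale a (quo_class v).
Proof.
apply/quo_classP; rewrite -scalerBr; apply: submoduleZ (submodP N) _ _ _.
by apply/quo_classP; rewrite quo_reprK.
Qed.

Lemma quo_scaleA a b q : quo_scale a (quo_scale b q) = quo_scale (a * b) q.
Proof. by rewrite -(quo_reprK q) -!quo_classZ scalerA. Qed.
Lemma quo_scale1 : left_id 1 quo_scale.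
Proof. by move=> q; rewrite -(quo_reprK q) -!quo_classZ scale1r. Qed.
Lemma quo_scaleDr : right_distributive quo_scale +%R.
Proof.
by move=> a p q; rewrite -(quo_reprK p) -(quo_reprK q) -quo_classD -!quo_classZ
  -quo_classD scalerDr.
Qed.
Lemma quo_scaleDl q : {morph quo_scale^~ q : a b / a + b}.
Proof.
by move=> a b; rewrite /= -(quo_reprK q) -!quo_classZ -quo_classD scalerDl.
Qed.

HB.instance Definition _ := GRing.Zmodule_isLmodule.Build A quomod
  quo_scaleA quo_scale1 quo_scaleDr quo_scaleDl.

Lemma quo_class_linear : linear quo_class.
Proof. by move=> a u v; rewrite quo_classD quo_classZ. Qed.

HB.instance Definition _ := GRing.isLinear.Build A M quomod _ quo_class quo_class_linear.

End SubmodType.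

(** ** The quotient of an algebra by a proper ideal *)

Record properIdeal (A : nzRingType) := ProperIdeal {
  proper_set :> A -> Prop;
  proper_is_ideal : ideal proper_set;
  proper_not1 : ~ proper_set 1
}.

Section QuotientRing.
Context (k : fieldType) (A : comAlgType k) (I : properIdeal A).

Let J : @submod A A^o := @Submod A A^o I (proper_is_ideal I).

Definition quoring : Type := quomod J.
HB.instance Definition _ := GRing.Zmodule.on quoring.

Definition qr_class (a : A) : quoring := quo_class J a.
Definition qr_repr (q : quoring) : A := @quo_repr A A^o J q.

Lemma qr_reprK q : qr_class (qr_repr q) = q. Proof. exact: quo_reprK. Qed.

Lemma qr_classP a b : qr_class a = qr_class b <-> I (a - b).
Proof. exact: (@quo_classP A A^o J). Qed.

Lemma qr_classD a b : qr_class (a + b) = qr_class a + qr_class b.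
Proof. exact: (@quo_classD A A^o J). Qed.

Definition qr_one : quoring := qr_class 1.
Definition qr_mul (p q : quoring) : quoring := qr_class (qr_repr p * qr_repr q).
Definition qr_scale (c : k) (q : quoring) : quoring := qr_class (c *: qr_repr q).

Lemma qr_idealM a b : I b -> I (a * b).
Proof. exact: (@submoduleZ A A^o I (proper_is_ideal I)). Qed.

Lemma qr_repr_class a : I (qr_repr (qr_class a) - a).
Proof. by apply/qr_classP; rewrite qr_reprK. Qed.

Lemma qr_classM a b : qr_class (a * b) = qr_mul (qr_class a) (qr_class b).
Proof.
apply/esym/qr_classP; set a' := qr_repr _; set b' := qr_repr _.
have -> : a' * b' - a * b = a' * (b' - b) + b * (a' - a).
  by rewrite !mulrBr addrA [b * a']mulrC [b * a]mulrC subrK.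
by apply: (@submoduleD A A^o I (proper_is_ideal I));
  apply: qr_idealM; apply: qr_repr_class.
Qed.

Lemma qr_classZ c a : qr_class (c *: a) = qr_scale c (qr_class a).
Proof.
apply/esym/qr_classP; rewrite -scalerBr -mulr_algl.
by apply: qr_idealM; apply: qr_repr_class.
Qed.

Lemma qr_mulA : associative qr_mul.
Proof.
by move=> x y z; rewrite -(qr_reprK x) -(qr_reprK y) -(qr_reprK z) -!qr_classM mulrA.
Qed.
Lemma qr_mulC : commutative qr_mul.
Proof. by move=> x y; rewrite -(qr_reprK x) -(qr_reprK y) -!qr_classM mulrC. Qed.
Lemma qr_mul1 : left_id qr_one qr_mul.
Proof. by move=> x; rewrite -(qr_reprK x) -!qr_classM mul1r. Qed.
Lemma qr_mulDl : left_distributive qr_mul +%R.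
Proof.
move=> x y z; rewrite -(qr_reprK x) -(qr_reprK y) -(qr_reprK z).
by rewrite -qr_classD -!qr_classM -qr_classD mulrDl.
Qed.
Lemma qr_one_neq0 : qr_one != 0.
Proof.
apply/eqP; have -> : 0 = qr_class 0 by rewrite /qr_class raddf0.
by move/qr_classP; rewrite subr0; exact: proper_not1.
Qed.

HB.instance Definition _ := GRing.Zmodule_isComNzRing.Build quoring
  qr_mulA qr_mulC qr_mul1 qr_mulDl qr_one_neq0.

Lemma qr_scaleA a b q : qr_scale a (qr_scale b q) = qr_scale (a * b) q.
Proof. by rewrite -(qr_reprK q) -!qr_classZ scalerA. Qed.
Lemma qr_scale1 : left_id 1 qr_scale.
Proof. by move=> q; rewrite -(qr_reprK q) -!qr_classZ scale1r. Qed.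
Lemma qr_scaleDr : right_distributive qr_scale +%R.
Proof.
by move=> a p q; rewrite -(qr_reprK p) -(qr_reprK q) -qr_classD -!qr_classZ
  -qr_classD scalerDr.
Qed.
Lemma qr_scaleDl q : {morph qr_scale^~ q : a b / a + b}.
Proof. by move=> a b; rewrite /= -(qr_reprK q) -!qr_classZ -qr_classD scalerDl. Qed.

HB.instance Definition _ := GRing.Zmodule_isLmodule.Build k quoring
  qr_scaleA qr_scale1 qr_scaleDr qr_scaleDl.

Lemma qr_scaleAl (c : k) (p q : quoring) : c *: (p * q) = (c *: p) * q.
Proof.
rewrite -(qr_reprK p) -(qr_reprK q).
by change (qr_scale c (qr_mul (qr_class (qr_repr p)) (qr_class (qr_repr q))) =
  qr_mul (qr_scale c (qr_class (qr_repr p))) (qr_class (qr_repr q)));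
  rewrite -qr_classM -!qr_classZ -qr_classM scalerAl.
Qed.

HB.instance Definition _ := GRing.Lmodule_isLalgebra.Build k quoring qr_scaleAl.
HB.instance Definition _ := GRing.Lalgebra_isComAlgebra.Build k quoring.

End QuotientRing.

(** ** A module killed by an ideal, as a module over the quotient ring *)

Section ModuleOverQuotient.
Context (k : fieldType) (A : comAlgType k) (I : properIdeal A) (M : lmodType A).

Definition kills := forall (a : A) (v : M), I a -> a *: v = 0.

(* Same carrier as [M]; the class of [a] modulo [I] acts as [a] does. *)
Definition overquo (killsM : kills) : Type := M.

Context (killsM : kills).
Local Notation V := (overquo killsM).
HB.instance Definition _ := GRing.Zmodule.copy V M.

Definition oq_scale (q : quoring I) (v : V) : V := qr_repr q *: (v : M).

Lemma oq_scaleE a (v : V) : oq_scale (qr_class I a) v = a *: (v : M).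
Proof.
by apply/eqP; rewrite -subr_eq0 -scalerBl killsM //; exact: qr_repr_class.
Qed.

Lemma oq_scaleA a b v : oq_scale a (oq_scale b v) = oq_scale (a * b) v.
Proof.
rewrite -(qr_reprK a) -(qr_reprK b).
change (qr_class I (qr_repr a) * qr_class I (qr_repr b)) with
  (qr_mul (qr_class I (qr_repr a)) (qr_class I (qr_repr b))).
by rewrite -qr_classM !oq_scaleE scalerA.
Qed.
Lemma oq_scale1 : left_id 1 oq_scale.
Proof. by move=> v; rewrite -[1]/(qr_class I 1) oq_scaleE scale1r. Qed.
Lemma oq_scaleDr : right_distributive oq_scale +%R.
Proof. by move=> a u v; rewrite /oq_scale scalerDr. Qed.
Lemma oq_scaleDl v : {morph oq_scale^~ v : a b / a + b}.
Proof.
move=> a b; rewrite /= -(qr_reprK a) -(qr_reprK b) -qr_classD !oq_scaleE.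
exact: scalerDl.
Qed.

HB.instance Definition _ := GRing.Zmodule_isLmodule.Build (quoring I) V
  oq_scaleA oq_scale1 oq_scaleDr oq_scaleDl.

End ModuleOverQuotient.

(** ** Quasi free modules *)

Lemma ideal_expP (A : nzRingType) (I : set A) (i : nat) : ideal (ideal_exp I i).
Proof. by case: i => [//|i]; exact: span_submodule. Qed.

Definition power_submod (A : nzRingType) (I : set A) (i : nat) : @submod A A^o :=
  @Submod A A^o (ideal_exp I i) (ideal_expP I i).

Definition power_quotient (A : nzRingType) (I : set A) (i : nat) : lmodType A :=
  quomod (power_submod I i).

(* The direct sum of [m i] copies of [A / I^i] for [1 <= i <= n]; [m 0] and the values
   of [m] beyond [n] are irrelevant. *)
Fixpoint quasi_free_module (A : nzRingType) (I : set A) (m : nat -> nat) (n : nat)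
    : lmodType A :=
  if n is i.+1 then
    (quasi_free_module I m i * {ffun 'I_(m i.+1) -> power_quotient I i.+1})%type
  else {ffun 'I_0 -> A^o}.

Definition quasi_free (A : nzRingType) (I : set A) (n : nat) (m : nat -> nat)
    (M : lmodType A) : Prop :=
  exists f : {linear M -> quasi_free_module I m n}, bijective f.

(** * Sheaves and ringed spaces *)

(* Sheaves are encoded by their etale spaces (Serre, Godement): a sheaf is the family of
   its stalks [F x] together with the topology of the disjoint union of the stalks.
   [sec x s] says that the family of germs [s] is, on some neighbourhood of [x], a
   section of the sheaf; the values of [s] away from [x] are irrelevant.  The sections
   over an open [U] are thus the families with [sec x s] for all [x] in [U], modulo
   agreement on [U].  The three conditions say that being a section is local, that two
   sections have the same germ at [x] iff they agree near [x], and that every element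
   of a stalk is the germ of a section. *)
Definition etale (X : topologicalType) (F : X -> Type)
    (sec : X -> (forall y, F y) -> Prop) : Prop :=
  [/\ forall x s, sec x s -> \forall y \near x, sec y s,
      forall x s t, sec x s ->
        (sec x t /\ s x = t x) <-> (\forall y \near x, s y = t y)
    & forall x (v : F x), exists2 s, sec x s & s x = v].

(* A space with a sheaf of commutative [k]-algebras with nonzero stalks; [c%:A] are the
   constant sections. *)
Record ringed_space (k : fieldType) := RingedSpace {
  points :> topologicalType;
  stalk : points -> comAlgType k;
  section_at : points -> (forall y, stalk y) -> Prop;
  section_etale : etale section_at;
  sectionC : forall x (c : k), section_at x (fun y => c%:A);
  sectionD : forall x s t, section_at x s -> section_at x t ->
    section_at x (fun y => s y + t y);
  sectionM : forall x s t, section_at x s -> section_at x t ->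
    section_at x (fun y => s y * t y)
}.

Record module_sheaf (k : fieldType) (X : ringed_space k) := ModuleSheaf {
  mstalk :> forall x : X, lmodType (stalk x);
  msection_at : X -> (forall y, mstalk y) -> Prop;
  msection_etale : etale msection_at;
  msectionD : forall x s t, msection_at x s -> msection_at x t ->
    msection_at x (fun y => s y + t y);
  msectionZ : forall x a s, section_at x a -> msection_at x s ->
    msection_at x (fun y => a y *: s y)
}.

(* A subsheaf of ideals of the structure sheaf.  [I x] may be the whole stalk. *)
Record ideal_sheaf (k : fieldType) (X : ringed_space k) := IdealSheaf {
  ideal_at :> forall x : X, set (stalk x);
  ideal_atP : forall x, ideal (@ideal_at x);
  ideal_open : forall x s, section_at x s -> @ideal_at x (s x) ->
    \forall y \near x, @ideal_at y (s y)
}.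
Arguments ideal_at {k X} _ _ _.

Section SheafTheory.
Context (k : fieldType) (X : ringed_space k).

Definition structure_sheaf : module_sheaf X :=
  @ModuleSheaf k X (fun x => (stalk x)^o) (@section_at k X) (@section_etale k X)
    (@sectionD k X) (@sectionM k X).

Lemma span_open (E : module_sheaf X) (S : forall y : X, set (E y)) :
  (forall x v, S x v -> exists s, [/\ msection_at x s, s x = v
     & \forall y \near x, span (S y) (s y)]) ->
  forall x s, msection_at x s -> span (S x) (s x) ->
    \forall y \near x, span (S y) (s y).
Proof.
move=> SE x s ss spans; have [_ Eeq Eex] := msection_etale E.
pose T := [set v : E x | exists s, [/\ msection_at x s, s x = v
     & \forall y \near x, span (S y) (s y)]].
have Tsub : submodule T.
  split=> [|a u v [su [su1 su2 su3]] [sv [sv1 sv2 sv3]]].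
    have [t tx t0] := Eex x 0; exists t; split=> //.
    have /(Eeq x t (fun y => 0%:A *: t y) tx) tE :
        msection_at x (fun y => 0%:A *: t y) /\ t x = 0%:A *: t x.
      by split; [apply: msectionZ => //; exact: sectionC|rewrite t0 scale0r scale0r].
    near=> y.
    have -> : t y = 0%:A *: t y by near: y.
    by rewrite !scale0r; exact: (span_submodule _).1.
  have [_ _ Oex] := section_etale X; have [c cx cE] := Oex x a.
  exists (fun y => c y *: su y + sv y); split.
  - by apply: msectionD => //; exact: msectionZ.
  - by rewrite cE su2 sv2.
  - near=> y; apply: (span_submodule _).2; first by near: y.
    by near: y.
have [t [tx tE tS]] := spans T (conj Tsub (fun v => SE x v)).
have /(Eeq x t s tx) tsE : msection_at x s /\ t x = s x by [].
by near=> y; have <- : t y = s y by [near: y]; near: y.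
Unshelve. all: by end_near. Qed.


Lemma ideal_mul_open (I J : ideal_sheaf X) x s :
  section_at x s -> ideal_mul (I x) (J x) (s x) ->
  \forall y \near x, ideal_mul (I y) (J y) (s y).
Proof.
apply: (@span_open structure_sheaf
  (fun y => [set a * b | a in I y & b in J y])) => {s} {}x v [a Ia [b Jb <-]].
have [_ _ Oex] := section_etale X.
have [s sx sa] := Oex x a; have [t tx tb] := Oex x b.
exists (fun y => s y * t y); split; [exact: sectionM|by rewrite sa tb|].
have Is : \forall y \near x, I y (s y) by apply: ideal_open; rewrite ?sa.
have Jt : \forall y \near x, J y (t y) by apply: ideal_open; rewrite ?tb.
near=> y; apply: sub_gen_smallest; exists (s y); first by near: y.
by exists (t y) => //; near: y.
Unshelve. all: by end_near. Qed.

Fact ideal_power_open (I : ideal_sheaf X) n x s :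
  section_at x s -> ideal_exp (I x) n (s x) ->
  \forall y \near x, ideal_exp (I y) n (s y).
Proof.
elim: n x s => [|n IHn] x s sx Is; first exact: nearW.
pose J := @IdealSheaf k X (fun y => ideal_exp (I y) n)
  (fun y => ideal_expP (I y) n) IHn.
exact: (@ideal_mul_open I J).
Qed.

Definition ideal_power (I : ideal_sheaf X) (n : nat) : ideal_sheaf X :=
  @IdealSheaf k X (fun y => ideal_exp (I y) n) (fun y => ideal_expP (I y) n)
    (@ideal_power_open I n).

Lemma ideal_scale_open (I : ideal_sheaf X) (E : module_sheaf X) x s :
  msection_at x s -> ideal_scale (I x) setT (s x) ->
  \forall y \near x, ideal_scale (I y) setT (s y : E y).
Proof.
apply: (@span_open E (fun y => [set a *: v | a in I y & v in setT]))
  => {s} {}x v [a Ia [w _ <-]].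
have [_ _ Oex] := section_etale X; have [_ _ Eex] := msection_etale E.
have [s sx sa] := Oex x a; have [t tx tb] := Eex x w.
exists (fun y => s y *: t y); split; [exact: msectionZ|by rewrite sa tb|].
have Is : \forall y \near x, I y (s y) by apply: ideal_open; rewrite ?sa.
near=> y; apply: sub_gen_smallest; exists (s y); first by near: y.
by exists (t y).
Unshelve. all: by end_near. Qed.

End SheafTheory.

(** ** Closed subspaces *)

Section Subscheme.
Context (k : fieldType) (X : ringed_space k) (J : ideal_sheaf X).

(* The closed subspace defined by [J]: the points where the stalk of [J] is proper, with
   the induced topology and the sheaf of rings whose stalks are the [O_x / J_x] and whose
   sections lift locally to sections on [X]. *)
Definition support : set X := [set x | ~ J x 1].

Definition support_ideal (y : support) : properIdeal (stalk (val y)) :=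
  @ProperIdeal (stalk (val y)) (J (val y)) (ideal_atP J (val y)) (set_mem (valP y)).

Definition sub_stalk (y : support) : comAlgType k := quoring (support_ideal y).

Definition sub_class (y : support) (a : stalk (val y)) : sub_stalk y :=
  qr_class (support_ideal y) a.

Definition sub_section_at (y : support) (s : forall z, sub_stalk z) : Prop :=
  exists2 t, section_at (val y) t & \forall z \near y, s z = sub_class (t (val z)).

Lemma near_support (y : support) (P : X -> Prop) :
  (\forall x \near val y, P x) -> \forall z \near y, P (val z).
Proof. exact: (@initial_continuous support X set_val y). Qed.

Lemma sub_classP (y : support) (a b : stalk (val y)) :
  sub_class a = sub_class b <-> J (val y) (a - b).
Proof. exact: qr_classP. Qed.

Lemma sectionB x (s t : forall y : X, stalk y) : section_at x s -> section_at x t ->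
  section_at x (fun y => s y - t y).
Proof.
move=> sx tx.
have -> : (fun y => s y - t y) = (fun y => s y + (-1)%:A * t y).
  by apply: functional_extensionality_dep => y; rewrite scaleN1r mulN1r.
by apply: sectionD => //; apply: sectionM => //; exact: sectionC.
Qed.

Fact sub_etale : etale sub_section_at.
Proof.
have [Oop Oeq Oex] := section_etale X; split.
- move=> y s [t ty sE].
  have ty' := near_support (Oop _ _ ty).
  have sE' := near_join sE.
  near=> z; exists t; first by near: z.
  by near: z.
- move=> y s s' [t ty sE]; split=> [[[t' ty' s'E] ss']|ss'].
    have Jt : \forall x \near val y, J x (t x - t' x).
      apply: ideal_open; first exact: sectionB.
      apply/sub_classP; have <- := nbhs_singleton sE.
      by rewrite ss'; exact: nbhs_singleton s'E.
    have {}Jt := near_support Jt.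
    near=> z; have -> : s z = sub_class (t (val z)) by near: z.
    have -> : s' z = sub_class (t' (val z)) by near: z.
    by apply/sub_classP; near: z.
  split; last exact: nbhs_singleton ss'.
  exists t => //; near=> z; have <- : s z = s' z by near: z.
  by near: z.
- move=> y q; have [t ty tq] := Oex (val y) (qr_repr q).
  exists (fun z => sub_class (t (val z))).
    by exists t; [exact: ty|near=> z].
  by rewrite /sub_class tq qr_reprK.
Unshelve. all: by end_near. Qed.

Fact sub_sectionC y (c : k) : sub_section_at y (fun z => c%:A).
Proof.
exists (fun x => c%:A); first exact: sectionC.
near=> z; by rewrite /sub_class qr_classZ.
Unshelve. all: by end_near.
Qed.

Fact sub_sectionD y s t : sub_section_at y s -> sub_section_at y t ->
  sub_section_at y (fun z => s z + t z).
Proof.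
move=> [s' ys sE] [t' yt tE]; exists (fun x => s' x + t' x); first exact: sectionD.
near=> z; rewrite /sub_class qr_classD.
by congr (_ + _); near: z.
Unshelve. all: by end_near. Qed.

Fact sub_sectionM y s t : sub_section_at y s -> sub_section_at y t ->
  sub_section_at y (fun z => s z * t z).
Proof.
move=> [s' ys sE] [t' yt tE]; exists (fun x => s' x * t' x); first exact: sectionM.
near=> z; rewrite /sub_class qr_classM.
change (qr_mul (s z : quoring (support_ideal z)) (t z) =
  qr_mul (sub_class (s' (val z))) (sub_class (t' (val z)))).
by congr (qr_mul _ _); near: z.
Unshelve. all: by end_near. Qed.

Definition subscheme : ringed_space k :=
  @RingedSpace k support sub_stalk sub_section_at sub_etale
    sub_sectionC sub_sectionD sub_sectionM.

End Subscheme.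

Section IdealIn.
Context (k : fieldType) (X : ringed_space k) (Y C : ideal_sheaf X).

(* The ideal sheaf [(C + Y) / Y] of [C] in [Y]; if [Y] is contained in [C] as an ideal,
   this is [C / Y], which defines [C] as a closed subscheme of [Y]. *)
Definition ideal_in_at (y : subscheme Y) : set (stalk y) :=
  [set sub_class a | a in C (val y)].

Fact ideal_in_atP (y : subscheme Y) : ideal (@ideal_in_at y).
Proof.
have CP := ideal_atP C (val y); split.
  exists 0; first exact: CP.1.
  by rewrite /sub_class /qr_class raddf0.
move=> q _ _ [a Ca <-] [b Cb <-].
exists (qr_repr q * a + b); first by apply: CP.2.
rewrite -[X in X *: _](qr_reprK q) /sub_class qr_classD qr_classM.
by [].
Qed.

Fact ideal_in_open (y : subscheme Y) s : section_at y s -> ideal_in_at (s y) ->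
  \forall z \near y, ideal_in_at (s z).
Proof.
have [Oop Oeq Oex] := section_etale X.
move=> [t ty sE] [a Ca asE].
have [t' ty' t'E] := Oex (val y) a.
have Jt : \forall x \near val y, Y x (t' x - t x).
  apply: ideal_open; first exact: sectionB.
  apply/sub_classP; rewrite t'E asE; exact: nbhs_singleton sE.
have Ct : \forall x \near val y, C x (t' x) by apply: ideal_open; rewrite ?t'E.
have {}Jt := near_support Jt; have {}Ct := near_support Ct.
near=> z; exists (t' (val z)); first by near: z.
have -> : s z = sub_class (t (val z)) by near: z.
by apply/sub_classP; near: z.
Unshelve. all: by end_near. Qed.

Definition ideal_in : ideal_sheaf (subscheme Y) :=
  @IdealSheaf k (subscheme Y) ideal_in_at ideal_in_atP ideal_in_open.

End IdealIn.

(** ** The graded pieces of a sheaf of modules *)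

(* [graded_piece I E i] is [I^i E / I^(i+1) E], as a sheaf of modules over the closed
   subspace of structure sheaf [O_X / I].  Its stalks are built as the submodule [I^i E_x]
   of [E_x], then its quotient by [I^(i+1) E_x], with the induced action of [O_x / I_x];
   its sections lift locally to sections of [E] with values in [I^i E]. *)
Section GradedPiece.
Context (k : fieldType) (X : ringed_space k) (I : ideal_sheaf X).
Context (E : module_sheaf X) (i : nat).

Definition power_scale (j : nat) (x : X) : submod (E x) :=
  @Submod _ (E x) (ideal_scale (ideal_power I j x) setT)
    (span_submodule _).

Definition sub_power (x : X) : lmodType (stalk x) := submod_type (power_scale i x).

Fact gr_kernelP (x : X) :
  submodule [set v : sub_power x | power_scale i.+1 x (val v)].
Proof.
have [P0 PZ] := submodP (power_scale i.+1 x).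
split=> [|a u v Pu Pv]; first exact: P0.
exact: PZ.
Qed.

Definition gr_kernel (x : X) : submod (sub_power x) := Submod (gr_kernelP x).

Definition gr_quotient (x : X) : lmodType (stalk x) := quomod (gr_kernel x).

Fact gr_killed (x : subscheme I) : kills (support_ideal x) (gr_quotient (val x)).
Proof.
move=> a q Ia; rewrite -(quo_reprK q) -linearZ_LR /=.
have -> : 0 = quo_class (gr_kernel (val x)) 0 by rewrite raddf0.
apply/quo_classP; rewrite subr0; set v := quo_repr q.
have /asboolP := valP v.
suff H : ideal_scale (ideal_power I i (val x)) setT `<=`
    [set w : E (val x) | power_scale i.+1 (val x) (a *: w)] by apply: H.
apply: smallest_sub; first split=> [|b u w].
- by rewrite /= scaler0; exact: (submodP (power_scale i.+1 (val x))).1.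
- move=> /= Pu Pw; rewrite scalerDr scalerA mulrC -scalerA.
  exact: (submodP (power_scale i.+1 (val x))).2.
- move=> _ [b Ib [w _ <-]] /=; rewrite scalerA.
  apply: sub_gen_smallest; exists (a * b); last by exists w.
  by apply: sub_gen_smallest; exists a => //; exists b.
Qed.

Definition gr_stalk (x : subscheme I) : lmodType (stalk x) :=
  overquo (@gr_killed x).

Definition gr_class (x : subscheme I) (v : sub_power (val x)) : gr_stalk x :=
  quo_class (gr_kernel (val x)) v.

Definition gr_section_at (x : subscheme I) (s : forall y, gr_stalk y) : Prop :=
  exists2 t, msection_at (val x) t
    & \forall y \near x, exists2 v, val v = t (val y) & s y = gr_class v.

Lemma msectionB x (s t : forall y, E y) : msection_at x s -> msection_at x t ->
  msection_at x (fun y => s y - t y).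
Proof.
move=> sx tx.
have -> : (fun y => s y - t y) = (fun y => s y + (-1)%:A *: t y).
  by apply: functional_extensionality_dep => y; rewrite !scaleN1r.
by apply: msectionD => //; apply: msectionZ => //; exact: sectionC.
Qed.

Lemma power_scale_open j x s : msection_at x s -> power_scale j x (s x) ->
  \forall y \near x, power_scale j y (s y).
Proof. exact: ideal_scale_open. Qed.

Lemma gr_classP (x : subscheme I) (u v : sub_power (val x)) :
  gr_class u = gr_class v <-> power_scale i.+1 (val x) (val u - val v).
Proof.
by rewrite -[val u - val v]/(val (u - v)); exact: (quo_classP (gr_kernel (val x))).
Qed.

Fact gr_etale : etale gr_section_at.
Proof.
have [Eop Eeq Eex] := msection_etale E; split.
- move=> x s [t tx sE].
  have tx' := near_support (Eop _ _ tx).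
  have sE' := near_join sE.
  near=> y; exists t; first by near: y.
  by near: y.
- move=> x s s' [t tx sE]; split=> [[[t' tx' s'E] ss']|ss'].
    have Nt : \forall y \near val x, power_scale i.+1 y (t y - t' y).
      apply: power_scale_open; first exact: msectionB.
      have [v <- sv] := nbhs_singleton sE; have [v' <- sv'] := nbhs_singleton s'E.
      by apply/gr_classP; rewrite -sv -sv'.
    have {}Nt := near_support Nt.
    near=> y.
    have [v vE ->] : exists2 v, val v = t (val y) & s y = gr_class v by near: y.
    have [w wE ->] : exists2 v, val v = t' (val y) & s' y = gr_class v by near: y.
    by apply/gr_classP; rewrite vE wE; near: y.
  split; last exact: nbhs_singleton ss'.
  exists t => //; near=> y; have <- : s y = s' y by near: y.
  by near: y.
- move=> x q; pose v := quo_repr q; have [t tx tv] := Eex (val x) (val v).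
  exists (fun y => gr_class (insubd 0 (t (val y)) : sub_power (val y))).
    exists t; first exact: tx.
    have Nt : \forall y \near val x, power_scale i y (t y).
      by apply: power_scale_open => //; rewrite tv; apply/asboolP/(valP v).
    have {}Nt := near_support Nt.
    near=> y; exists (insubd 0 (t (val y))) => //.
    by rewrite insubdK //; apply/asboolP; near: y.
  by rewrite tv valKd; exact: quo_reprK.
Unshelve. all: by end_near. Qed.

Fact gr_sectionD x s t : gr_section_at x s -> gr_section_at x t ->
  gr_section_at x (fun y => s y + t y).
Proof.
move=> [s' xs sE] [t' xt tE]; exists (fun y => s' y + t' y); first exact: msectionD.
near=> y.
have [v vE ->] : exists2 v, val v = s' (val y) & s y = gr_class v by near: y.
have [w wE ->] : exists2 v, val v = t' (val y) & t y = gr_class v by near: y.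
exists (v + w); first by rewrite raddfD /= vE wE.
by rewrite /gr_class raddfD.
Unshelve. all: by end_near. Qed.

Fact gr_sectionZ x a s : section_at x a -> gr_section_at x s ->
  gr_section_at x (fun y => a y *: s y).
Proof.
move=> [a' xa aE] [s' xs sE]; exists (fun y => a' y *: s' y); first exact: msectionZ.
near=> y.
have [v vE ->] : exists2 v, val v = s' (val y) & s y = gr_class v by near: y.
have -> : a y = sub_class (a' (val y)) by near: y.
exists (a' (val y) *: v); first by rewrite linearZ /= vE.
rewrite /gr_class linearZ /=; exact: (@oq_scaleE _ _ _ _ (@gr_killed y)).
Unshelve. all: by end_near. Qed.

Definition graded_piece : module_sheaf (subscheme I) :=
  @ModuleSheaf k (subscheme I) gr_stalk gr_section_at gr_etale gr_sectionD gr_sectionZ.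

End GradedPiece.

(** ** Conditions on sheaves of modules *)

Section ModuleConditions.
Context (k : fieldType) (X : ringed_space k) (E : module_sheaf X).

(* Coherence in the sense of Serre: [E] is of finite type and so is the kernel of any
   morphism [O_U^m -> E] over an open [U]. *)
Definition finite_type_module : Prop :=
  forall x : X, exists m (e : 'I_m -> forall y, E y), \forall y \near x,
    (forall i, msection_at y (e i)) /\
    forall v : E y, exists c : 'I_m -> stalk y, v = \sum_i c i *: e i y.

Definition finite_type_relations : Prop :=
  forall (x : X) m (e : 'I_m -> forall y, E y), (forall i, msection_at x (e i)) ->
    exists l (r : 'I_l -> 'I_m -> forall y : X, stalk y), \forall y \near x,
      (forall j i, section_at y (r j i)) /\
      forall c : 'I_m -> stalk y, \sum_i c i *: e i y = 0 <->
        exists d : 'I_l -> stalk y, forall i, c i = \sum_j d j * r j i y.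

Definition coherent : Prop := finite_type_module /\ finite_type_relations.

(* Sections [e i] near [x] define an isomorphism of [O^r] with [E] near [x]. *)
Definition locally_free : Prop :=
  forall x : X, exists r (e : 'I_r -> forall y, E y), \forall y \near x,
    (forall i, msection_at y (e i)) /\
    forall v : E y, exists! c : {ffun 'I_r -> stalk y}, v = \sum_i c i *: e i y.

(* To be used with [I] the ideal sheaf of the support in a multiple curve of
   multiplicity [n]. *)
Definition quasi_locally_free_at (I : ideal_sheaf X) (n : nat) (x : X) : Prop :=
  exists m : nat -> nat, \forall y \near x, quasi_free (I y) n m (E y).

Definition quasi_locally_free (I : ideal_sheaf X) (n : nat) : Prop :=
  forall x : X, quasi_locally_free_at I n x.

End ModuleConditions.

(** * Schemes over a field *)

Section Schemes.
Context (k : fieldType).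
Implicit Types X Y : ringed_space k.

(* [phi] induces an isomorphism of [Spec A] with the open subspace [U] of [X]:
   [x |-> phi x @^-1` nonunits] is a bijection from [U] to the prime ideals of [A], the
   [D(a)] form a basis of [U], and [stalk x] is the localization of [A] at the prime of
   [x].  That sections are then the families that are locally fractions follows from
   [chart_section] and [section_etale].  [phi x] is irrelevant for [x] outside [U]. *)
Record affine_chart X (A : comAlgType k) (U : set X) (phi : forall x : X, A -> stalk x)
    : Prop := {
  chart_open : open U;
  chart_section : forall a x, U x -> section_at x (phi^~ a);
  chart_linear : forall x, U x -> linear (phi x);
  chart_one : forall x, U x -> phi x 1 = 1;
  chart_mul : forall x, U x -> {morph phi x : a b / a * b};
  chart_prime : forall x, U x -> prime_ideal (phi x @^-1` @nonunits (stalk x));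
  chart_point : forall p : set A, prime_ideal p ->
    exists! x, U x /\ p = phi x @^-1` @nonunits (stalk x);
  chart_basis : forall x V, U x -> nbhs x V -> exists a, invertible (phi x a) /\
    forall y, U y -> invertible (phi y a) -> V y;
  chart_fraction : forall x, U x -> forall f : stalk x,
    exists a b, invertible (phi x b) /\ f * phi x b = phi x a;
  chart_zero : forall x, U x -> forall a, phi x a = 0 ->
    exists b, invertible (phi x b) /\ a * b = 0
}.

(* [compact] is quasi-compactness: no separation is involved. *)
Definition finite_type_scheme X : Prop :=
  compact [set: X] /\
  forall x : X, exists (A : comAlgType k) (U : set X) (phi : forall y : X, A -> stalk y),
    [/\ U x, fg_algebra A & affine_chart U phi].

Definition closed_point X (x : X) : Prop := closed [set x].

(* The diagonal is closed in the product over [k], for [k] algebraically closed: each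
   closed point [(x, y)] off the diagonal lies in an open [D(h)] of [U * V] that
   misses the diagonal, with [h = \sum_i a i (x) b i].  [va i] and [vb i] are the values
   of [a i] at [x] and of [b i] at [y] in the residue field [k]. *)
Definition separated X : Prop :=
  forall x y : X, closed_point x -> closed_point y -> x <> y ->
  exists (U V : set X) m (a b : 'I_m -> forall z : X, stalk z) (va vb : 'I_m -> k),
    [/\ [/\ open U, open V, U x & V y],
        forall i z, (U z -> section_at z (a i)) /\ (V z -> section_at z (b i)),
        forall i, @nonunits (stalk x) (a i x - (va i)%:A) /\
                  @nonunits (stalk y) (b i y - (vb i)%:A),
        \sum_i va i * vb i != 0
      & forall z, U z -> V z -> @nonunits (stalk z) (\sum_i a i z * b i z)].

Definition irreducible X : Prop :=
  [set: X] !=set0 /\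
  forall U V : set X, open U -> open V -> U !=set0 -> V !=set0 -> U `&` V !=set0.

Definition reduced X : Prop :=
  forall (x : X) (a : stalk x) m, a ^+ m = 0 -> a = 0.

(* Nonsingularity, which is smoothness over a perfect field; at closed points the local
   rings have the dimension of the scheme. *)
Definition smooth_of_dim X (d : nat) : Prop :=
  (forall x : X, exists e, regular_local (stalk x) e) /\
  (forall x : X, closed_point x -> regular_local (stalk x) d).

Definition cohen_macaulay X : Prop := forall x : X, cohen_macaulay_local (stalk x).

Definition isomorphic X Y : Prop :=
  exists (f : X -> Y) (g : Y -> X) (phi : forall x, {lrmorphism stalk (f x) -> stalk x}),
    [/\ continuous f, continuous g, cancel f g & cancel g f] /\
    [/\ forall x, bijective (phi x)
      & forall x s, section_at (f x) s -> section_at x (fun y => phi y (s (f y)))].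

(* On a locally noetherian scheme, closed subschemes correspond to coherent ideal
   sheaves, that is to those that are locally generated by finitely many sections. *)
Record closed_subscheme X := ClosedSubscheme {
  closed_ideal :> ideal_sheaf X;
  closed_ideal_coherent : forall x : X, exists m (s : 'I_m -> forall y : X, stalk y),
    \forall y \near x, (forall i, section_at y (s i)) /\
      closed_ideal y = ideal_span [set s i y | i in setT]
}.

(* [P] is glued from the affine spaces [U j], [j <= N], with coordinates the
   [ratio j i = X_i / X_j], [i != j]; the overlap of [U i] and [U j] is the locus of [U j]
   where [X_i / X_j] is invertible. *)
Definition projective_space (N : nat) (P : ringed_space k) : Prop :=
  exists (U : 'I_N.+1 -> set P)
         (phi : forall (j : 'I_N.+1) (x : P), {mpoly k[N]} -> stalk x),
  let ratio j i x := if unlift j i is Some l then phi j x 'X_l else 1 in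
  [/\ forall x, exists j, U j x,
      forall j, affine_chart (U j) (phi j),
      forall i j x, U j x -> (U i x <-> invertible (ratio j i x))
    & forall i j l x, U i x -> U j x -> ratio j l x = ratio j i x * ratio i l x].

Definition projective X : Prop :=
  exists N (P : ringed_space k) (Z : closed_subscheme P),
    projective_space N P /\ isomorphic X (subscheme Z).

(** ** Primitive multiple curves *)

Definition smooth_threefold X : Prop :=
  [/\ finite_type_scheme X, separated X, connected [set: X] & smooth_of_dim X 3].

Definition smooth_projective_curve X : Prop :=
  [/\ irreducible X, projective X & smooth_of_dim X 1].

(* [S] is an integral closed surface through [P], smooth at [P]; [S x `<=` Y x] near [P]
   says that [S] contains a neighbourhood of [P] in [Y]. *)
Definition in_smooth_surface_near X (Y : closed_subscheme X) (P : X) : Prop :=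
  exists S : closed_subscheme X,
    [/\ irreducible (subscheme S), reduced (subscheme S),
        exists2 p : subscheme S, val p = P & regular_local (stalk p) 2
      & \forall x \near P, S x `<=` Y x].

Definition multiplicity X (C Y : closed_subscheme X) (n : nat) : Prop :=
  (forall x : X, ideal_exp (C x) n `<=` Y x) /\
  forall m, (forall x : X, ideal_exp (C x) m `<=` Y x) -> (n <= m)%N.

(* [pmc_reduced]: the ideal sheaf of the reduced subscheme of [Y] is the radical of that
   of [Y]. *)
Record primitive_multiple_curve X (C Y : closed_subscheme X) (n : nat) : Prop := {
  pmc_ambient : smooth_threefold X;
  pmc_support : smooth_projective_curve (subscheme C);
  pmc_cohen_macaulay : cohen_macaulay (subscheme Y);
  pmc_reduced : forall x : X, C x = radical (Y x);
  pmc_surface : forall P : X, closed_point P -> support C P -> in_smooth_surface_near Y P;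
  pmc_multiplicity : multiplicity C Y n
}.

End Schemes.

(* Main.v *)
From HB Require Import structures.
Require Import Defs.
From mathcomp Require Import all_boot all_order all_algebra.
From mathcomp Require Import all_classical reals topology complex.
From mathcomp Require Import ring.

(* Let A be the local ring of C_n at a point, I = (z) the ideal of C in A, and M the stalk
   of E.  If all z^j M / z^(j+1) M are free over A / I, a basis of M adapted to the
   filtration is built by descending induction on j: generators of z^(j+1) M, each of which
   spans a copy of some A / z^i, are lifted through multiplication by z to part of a basis of
   z^j M / z^(j+1) M, and the missing basis vectors are corrected by combinations of these
   lifts so that z kills them.  So M is quasi free, and its type is determined by the ranks,
   which are locally constant.

   Conversely, if M is quasi free and the elements outside I are nonzerodivisors of A, the
   graded pieces of M are free, and by coherence their bases extend to a neighbourhood.  It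
   is enough to do this at closed points, since every point specializes to one.  There the
   surface containing C_n makes the maximal ideal of A generated by two elements, which
   together with the regularity of A / I makes I principal, and the Cohen-Macaulay property
   provides a nonzerodivisor in the maximal ideal, hence that all the elements outside I are
   nonzerodivisors. *)

Set Implicit Arguments.
Unset Strict Implicit.
Unset Printing Implicit Defensive.

Import GRing.Theory.
Local Open Scope classical_set_scope.
Local Open Scope ring_scope.

(** * Bases of graded pieces *)

Section QuotientBasis.
Context (A : comNzRingType) (M : lmodType A).
Implicit Types (I : set A) (P N K : set M).

(* The classes of [g] form a basis of [P / N] over [A / I]; stating this without forming the
   quotients lets bases vary with the point of a sheaf. *)
Definition quotient_basis I P N (T : finType) (g : T -> M) : Prop :=
  [/\ forall t, P (g t),
      forall v, P v -> exists c : T -> A, N (v - \sum_t c t *: g t)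
    & forall c : T -> A, N (\sum_t c t *: g t) -> forall t, I (c t)].

Lemma quotient_basis_reindex I P N (T T' : finType) (g : T -> M) (h : T' -> T) :
  bijective h -> quotient_basis I P N g -> quotient_basis I P N (g \o h).
Proof.
move=> bh; have [h' hK h'K] := bh; move=> [gP gG gI].
have sumE (c : T' -> A) : \sum_t c t *: g (h t) = \sum_t c (h' t) *: g t.
  rewrite [RHS](reindex h) /=; last exact: onW_bij.
  by apply: eq_bigr => t _; rewrite hK.
split=> [t|v /gG[c cN]|c]; first exact: gP.
  exists (c \o h); rewrite sumE.
  by under eq_bigr => t _ do rewrite /= h'K.
by rewrite sumE => /gI cI t; rewrite -[t]hK; exact: cI.
Qed.

(** Since [c t0] is invertible, the relation expressing [u] can be solved for [g t0] modulo [N]. *)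
Lemma quotient_basis_replace I P N (T : finType) (g : T -> M) t0 u c :
  ideal I -> submodule N -> P u ->
  N (u - \sum_t c t *: g t) -> invertible (c t0) ->
  quotient_basis I P N g ->
  quotient_basis I P N (fun t => if t == t0 then u else g t).
Proof.
move=> II NN Pu uN [b [cb bc]] [gP gG gI].
(* A combination of the new family is one of the old family up to a multiple of
   [u - \sum_t c t *: g t], which lies in [N]. *)
have sumE (a : T -> A) : \sum_t a t *: (if t == t0 then u else g t) =
    a t0 *: (u - \sum_t c t *: g t) +
    \sum_t (if t == t0 then a t0 * c t0 else a t + a t0 * c t) *: g t.
  rewrite (bigD1 t0) //= eqxx scalerBr -!addrA; congr (_ + _).
  rewrite [X in - (_ *: X)](bigD1 t0) //= scalerDr opprD.
  rewrite [X in _ = _ + X](bigD1 t0) //= eqxx scalerA addrACA addNr add0r.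
  rewrite scaler_sumr -sumrN -big_split /=; apply: eq_bigr => t /negPf ->.
  by rewrite scalerA scalerDl addrC addrK.
split=> [t|v /gG[a aN]|a]; first by case: eqP.
  exists (fun t => if t == t0 then a t0 * b else a t - a t0 * b * c t).
  rewrite sumE eqxx.
  have -> : \sum_t (if t == t0 then a t0 * b * c t0 else
       (if t == t0 then a t0 * b else a t - a t0 * b * c t) + a t0 * b * c t) *: g t
      = \sum_t a t *: g t.
    apply: eq_bigr => t _; case: eqP => [->|_]; last by rewrite subrK.
    by rewrite -mulrA bc mulr1.
  rewrite opprD addrCA; apply: submoduleD => //; apply: submoduleN => //.
  exact: submoduleZ.
rewrite sumE => aN.
have /gI dI : N (\sum_t (if t == t0 then a t0 * c t0 else a t + a t0 * c t) *: g t).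
  rewrite -[X in N X](addKr (a t0 *: (u - \sum_t c t *: g t))).
  by apply: submoduleD => //; apply: submoduleN => //; exact: submoduleZ.
have at0 : I (a t0).
  have := dI t0; rewrite eqxx => /(@submoduleZ A A^o _ II b).
  by rewrite /GRing.scale /= mulrCA bc mulr1.
move=> t; have := dI t; case: eqP => [-> //|_ atI].
rewrite -(addrK (a t0 * c t) (a t)); apply: (@submoduleB A A^o _ II) => //.
by rewrite mulrC; apply: (@submoduleZ A A^o _ II).
Qed.

(* Steinitz exchange over a local ring: among the coefficients of [u x] on [g], one that
   is not attached to an already inserted vector is invertible, as otherwise expanding
   everything on [u] modulo [K] would make [1] a nonunit. *)
Lemma quotient_basis_insert I P N K (S T : finType) (u : S -> M) (g : T -> M) :
  local_ring A -> ideal I -> submodule N -> submodule K -> N `<=` K ->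
  quotient_basis (@nonunits A) P K u -> quotient_basis I P N g ->
  exists (w : T -> M) (s : S -> T),
    [/\ quotient_basis I P N w, injective s & w \o s =1 u].
Proof.
move=> Aloc II NN KK NK [uP uG uI] gB.
have [_ not1] : True /\ ~ @nonunits A 1.
  by split=> //; apply; exists 1; rewrite mulr1.
(* The vectors are inserted one at a time along a list; [s] is option-valued because vectors outside
   the list have no position yet. *)
suff H (l : seq S) : uniq l -> exists (w : T -> M) (s : S -> option T),
    [/\ quotient_basis I P N w, {in l &, injective s}
      & forall x, x \in l -> exists2 t, s x = Some t & w t = u x].
  have [w [s [wB sI sw]]] := H _ (enum_uniq S).
  have sS x : {t | s x = Some t & w t = u x}.
    by apply: cid2; apply: sw; rewrite mem_enum.
  exists w, (fun x => s2val (sS x)); split=> // [x y xy|x] /=; last by case: (sS x).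
  apply: sI; rewrite ?mem_enum //.
  by rewrite (s2valP (sS x)) (s2valP (sS y)) xy.
elim: l => [|x l IHl] /=; first by exists g, (fun=> None).
case/andP=> xl /IHl[w [s [wB sI sw]]]; have [wP wG wI] := wB.
have [c cN] := wG _ (uP x).
(* [y t] expands [w t] on [u] modulo [K]. For a position already holding some [u z] the trivial
   expansion is chosen; its coefficient on [u x] is 0 because [x] is not in [l]. *)
have [y yK] : exists y : T -> S -> A, forall t,
    K (w t - \sum_z y t z *: u z) /\ ((exists2 z, z \in l & s z = Some t) -> y t x = 0).
  suff /boolp.choice[y yK] : forall t, exists yt : S -> A,
      K (w t - \sum_z yt z *: u z) /\ ((exists2 z, z \in l & s z = Some t) -> yt x = 0).
    by exists y.
  move=> t.
  have [[z zl sz]|no] := pselect (exists2 z, z \in l & s z = Some t).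
    exists (fun z' => (z' == z)%:R); split=> [|_]; last first.
      by case: eqP xl => // ->; rewrite zl.
    have [t' st' wt'] := sw z zl.
    have -> : w t = u z by rewrite -wt'; congr w; move: st'; rewrite sz => -[].
    rewrite (bigD1 z) //= eqxx scale1r big1 ?addr0 ?subrr; first exact: submodule0.
    by move=> z' /negPf ->; rewrite scale0r.
  by have [yt] := uG _ (wP t); exists yt.
(* Substituting these expansions in that of [u x] gives a relation whose coefficient on [u x] is
   [1 - \sum_t c t * y t x], a nonunit. If no free position had an invertible coefficient, the sum
   would be a nonunit too, hence also 1. *)
have [t0 [ct0 st0]] : exists t0, invertible (c t0) /\ ~ (exists2 z, z \in l & s z = Some t0).
  apply: contrapT => no.
  have cU t : ~ (exists2 z, z \in l & s z = Some t) -> nonunits (c t).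
    by move=> nt ct; apply: no; exists t.
  have : K (\sum_z ((z == x)%:R - \sum_t c t * y t z) *: u z).
    have -> : \sum_z ((z == x)%:R - \sum_t c t * y t z) *: u z =
        (u x - \sum_t c t *: w t) + \sum_t c t *: (w t - \sum_z y t z *: u z).
      transitivity (u x - \sum_z \sum_t (c t * y t z) *: u z).
        under eq_bigr => z _ do rewrite scalerBl scaler_suml.
        rewrite sumrB (bigD1 x) //= eqxx scale1r big1 ?addr0 //.
        by move=> z /negPf ->; rewrite scale0r.
      under [X in _ = _ + X]eq_bigr => t _ do rewrite scalerBr.
      rewrite [in RHS]sumrB addrA subrK exchange_big /=; congr (_ - _).
      apply: eq_bigr => t _; rewrite scaler_sumr.
      by apply: eq_bigr => z _; rewrite scalerA.
    apply: submoduleD => //; first exact: NK.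
    have KS (F : T -> M) : (forall t, K (F t)) -> K (\sum_t F t).
      move=> KF; elim/big_ind: _ => //; first exact: submodule0.
      by move=> ? ?; exact: submoduleD.
    by apply: KS => t; apply: submoduleZ => //; have [] := yK t.
  move/uI/(_ x); rewrite eqxx => n1.
  apply: not1; rewrite -(subrK (\sum_t c t * y t x) 1).
  apply: (@submoduleD A A^o _ Aloc) => //.
  elim/big_ind: _ => [|a b|t _]; first exact: (@submodule0 A A^o _ Aloc).
    exact: (@submoduleD A A^o _ Aloc).
  have [ex|nex] := pselect (exists2 z, z \in l & s z = Some t).
    by rewrite (yK t).2 // mulr0; exact: (@submodule0 A A^o _ Aloc).
  by rewrite mulrC; apply: (@submoduleZ A A^o _ Aloc); exact: cU.
exists (fun t => if t == t0 then u x else w t), (fun z => if z == x then Some t0 else s z).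
split; first exact: quotient_basis_replace ct0 wB.
- move=> a b; rewrite !inE.
  case: (eqVneq a x) => [->|/negPf ax] /=; case: (eqVneq b x) => [->|/negPf bx] //=.
  + by move=> _ bl sb; case: st0; exists b.
  + by move=> al _ sa; case: st0; exists a.
  + exact: sI.
- move=> a; rewrite inE; case: (eqVneq a x) => [->|/negPf ax] /=.
    by exists t0; rewrite ?eqxx.
  move=> al; have [t st wt] := sw a al; exists t => //.
  by case: eqP => // tt0; case: st0; exists a; rewrite // -tt0.
Qed.

(** The added vectors are those of the exchanged basis at the positions not taken by [u]. *)
Lemma quotient_basis_extend I P N K (S T : finType) (u : S -> M) (g : T -> M) :
  local_ring A -> ideal I -> submodule N -> submodule K -> N `<=` K ->
  quotient_basis (@nonunits A) P K u -> quotient_basis I P N g ->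
  exists k (b : 'I_k -> M), (#|S| + k)%N = #|T| /\
    quotient_basis I P N (fun x : S + 'I_k => match x with inl s => u s | inr i => b i end).
Proof.
move=> Aloc II NN KK NK uB gB.
have [w [s [wB sI sw]]] := quotient_basis_insert Aloc II NN KK NK uB gB.
pose D := [pred t | t \notin codom s].
pose h (x : S + 'I_#|D|) : T := match x with inl x => s x | inr i => enum_val i end.
have hD i : h (inr i) \notin codom s by exact: (@enum_valP _ D).
have hI : injective h.
  move=> [x|i] [y|j] //=; first by move/sI ->.
  - by move=> sx; have := hD j; rewrite /= -sx codom_f.
  - by move=> sx; have := hD i; rewrite /= sx codom_f.
  - by move/enum_val_inj ->.
have cT : (#|S| + #|D|)%N = #|T|.
  rewrite -(card_codom sI) -(cardC (mem (codom s))); congr (_ + _)%N.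
have hB : bijective h by apply: inj_card_bij => //; rewrite card_sum card_ord cT.
exists #|D|, (fun i => w (enum_val i)); split=> //.
have := quotient_basis_reindex hB wB.
congr quotient_basis; apply/funext => -[x|i] //=; exact: sw.
Qed.

End QuotientBasis.

(** * Double sums with natural number indices *)

Section DoubleSum.
Context (V : nmodType).
Implicit Types (m : nat -> nat) (F : nat -> nat -> V).

(** Natural number indices allow ranges to be shifted and split without dependent casts; [dsum_sig]
    returns to a finite type of pairs when a single sum is wanted. *)
Definition dsum (d : nat) m F : V := \sum_(i < d) \sum_(k < m i) F i k.

Lemma eq_dsum d m F G : (forall i k, (i < d)%N -> (k < m i)%N -> F i k = G i k) ->
  dsum d m F = dsum d m G.
Proof. by move=> FG; apply: eq_bigr => i _; apply: eq_bigr => k _; exact: FG. Qed.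

Lemma dsum_recl d m F : dsum d.+1 m F =
  \sum_(k < m 0) F 0 k + dsum d (fun i => m i.+1) (fun i => F i.+1).
Proof. by rewrite /dsum big_ord_recl. Qed.

Lemma dsum_sig d m F : dsum d m F =
  \sum_(p : {i : 'I_d & 'I_(m i)}) F (tag p) (tagged p).
Proof.
exact: (@sig_big_dep _ _ _ _ (fun i : 'I_d => 'I_(m i)) xpredT (fun=> xpredT)
  (fun i k => F i k)).
Qed.

Lemma dsumD d m F G : dsum d m (fun i k => F i k + G i k) = dsum d m F + dsum d m G.
Proof.
by rewrite /dsum -big_split; apply: eq_bigr => i _; rewrite big_split.
Qed.

End DoubleSum.

Lemma dsumZ (A : nzRingType) (M : lmodType A) d m (a : A) (F : nat -> nat -> M) :
  a *: dsum d m F = dsum d m (fun i k => a *: F i k).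
Proof.
by rewrite /dsum scaler_sumr; apply: eq_bigr => i _; rewrite scaler_sumr.
Qed.

Lemma dsum_sumZ (A : nzRingType) (M : lmodType A) d m l (c : 'I_l -> A)
    (a : 'I_l -> nat -> nat -> A) (g : nat -> nat -> M) :
  dsum d m (fun i k => (\sum_x c x * a x i k) *: g i k) =
  \sum_x c x *: dsum d m (fun i k => a x i k *: g i k).
Proof.
under [RHS]eq_bigr => x _ do rewrite dsum_sig scaler_sumr.
rewrite exchange_big dsum_sig; apply: eq_bigr => p _.
by rewrite scaler_suml; apply: eq_bigr => x _; rewrite scalerA.
Qed.

Lemma ord_fun_extend (V : Type) (v0 : V) k (c : 'I_k -> V) :
  exists a : nat -> V, forall i : 'I_k, a i = c i.
Proof.
exists (fun i => if insub i is Some i' then c i' else v0) => i.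
by rewrite valK.
Qed.

Lemma sig_fun_extend (V : Type) (v0 : V) d (m : nat -> nat)
    (c : {i : 'I_d & 'I_(m i)} -> V) :
  exists a : nat -> nat -> V,
    forall p : {i : 'I_d & 'I_(m i)}, a (tag p) (tagged p) = c p.
Proof.
exists (fun i k => if (insub i : option 'I_d) is Some i' then
  if (insub k : option 'I_(m i')) is Some k' then c (existT _ i' k') else v0
  else v0) => -[i k] /=.
by rewrite !valK.
Qed.

(** * Generators adapted to the filtration by powers of [z] *)

Section AdaptedFamily.
Context (A : comNzRingType) (z : A).

Definition multiples (e : nat) : set A := [set a | exists b, a = b * z ^+ e].
Definition power_image (M : lmodType A) (e : nat) : set M :=
  [set v | exists w, v = z ^+ e *: w].

Lemma multiples_ideal e : ideal (multiples e).
Proof.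
split=> [|a u v [b ->] [c ->]]; first by exists 0; rewrite mul0r.
by exists (a * b + c); rewrite mulrDl /GRing.scale /= mulrA.
Qed.

Lemma power_image_submodule (M : lmodType A) e : submodule (@power_image M e).
Proof.
split=> [|a u v [b ->] [c ->]]; first by exists 0; rewrite scaler0.
by exists (a *: b + c); rewrite scalerDr !scalerA mulrC.
Qed.

(** Basis vectors are recorded by preimages under multiplication by [z ^+ j], because these
    preimages are what gets lifted and corrected. *)
Definition graded_basis (M : lmodType A) (j : nat) (T : finType) (w : T -> M) : Prop :=
  quotient_basis (multiples 1) (@power_image M j) (@power_image M j.+1)
    (fun t => z ^+ j *: w t).

(* [z^j M] is the direct sum of the cyclic modules generated by the [z^j v i k], which are
   isomorphic to [A / z^(i+1)]: indices [i] start at 0. *)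
Definition adapted (M : lmodType A) (j d : nat) (m : nat -> nat) (v : nat -> nat -> M) :=
  [/\ forall i k, (i < d)%N -> (k < m i)%N -> z ^+ (j + i).+1 *: v i k = 0,
      forall w, exists a : nat -> nat -> A,
        z ^+ j *: w = dsum d m (fun i k => a i k *: (z ^+ j *: v i k))
    & forall a : nat -> nat -> A, dsum d m (fun i k => a i k *: (z ^+ j *: v i k)) = 0 ->
        forall i k, (i < d)%N -> (k < m i)%N -> multiples i.+1 (a i k)].

(* Lifting a basis of [z^(j+1) M] through multiplication by [z] gives part of a basis of
   [z^j M / z^(j+1) M]; the remaining basis vectors can be corrected so that [z] kills
   their images [z^j v]. *)
Lemma adapted_step (M : lmodType A) (j d : nat) (m : nat -> nat) (v : nat -> nat -> M) r
    (g : 'I_r -> M) :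
  local_ring A -> nonunits z -> adapted j.+1 d m v -> graded_basis j g ->
  exists v0, (\sum_(i < d) m i <= r)%N /\
    adapted j d.+1
      (fun i => if i is i'.+1 then m i' else r - \sum_(i < d) m i)%N
      (fun i => if i is i'.+1 then v i' else v0).
Proof.
move=> Aloc zN [vk vG vI] gB.
pose S := {i : 'I_d & 'I_(m i)} : finType.
pose u (p : S) := z ^+ j *: v (tag p) (tagged p).
(* Multiplication by [z] identifies [z^j M] modulo [K] with [z^(j+1) M / z^(j+2) M]. So [u] spans
   modulo [K], and in a relation modulo [K] adaptedness at [j.+1] makes the coefficients multiples
   of [z], hence nonunits. *)
pose K := [set x : M | exists w, z *: x = z ^+ j.+2 *: w].
have KK : submodule K.
  split=> [|a x y [b bE] [c cE]]; first by exists 0; rewrite !scaler0.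
  exists (a *: b + c); rewrite scalerDr scalerA mulrC -scalerA bE cE.
  by rewrite [in RHS]scalerDr !scalerA mulrC.
have NK : power_image j.+1 `<=` K.
  by move=> _ [w ->]; exists w; rewrite scalerA -exprS.
have zsum (c : S -> A) (a : nat -> nat -> A) : (forall p : S, a (tag p) (tagged p) = c p) ->
    z *: \sum_p c p *: u p = dsum d m (fun i k => a i k *: (z ^+ j.+1 *: v i k)).
  move=> ac; rewrite dsum_sig scaler_sumr; apply: eq_bigr => p _.
  by rewrite ac /u !scalerA exprS mulrCA mulrA.
have uB : quotient_basis (@nonunits A) (power_image j) K u.
  split=> [p|_ [w ->]|c [w zw]]; first by exists (v (tag p) (tagged p)).
    have [a aE] := vG w; exists (fun p : S => a (tag p) (tagged p)), 0.
    by rewrite scaler0 scalerBr (zsum _ a) // -aE scalerA -exprS subrr.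
  have [a ac] := sig_fun_extend 0 c.
  have [b bE] := vG w.
  move=> p; rewrite -ac.
  have /(vI (fun i k => a i k - z * b i k)) H :
      dsum d m (fun i k => (a i k - z * b i k) *: (z ^+ j.+1 *: v i k)) = 0.
    rewrite (eq_dsum (G := fun i k => a i k *: (z ^+ j.+1 *: v i k) +
      (- z) *: (b i k *: (z ^+ j.+1 *: v i k)))); last first.
      by move=> i k _ _; rewrite scalerBl scaleNr !scalerA !mulrA.
    by rewrite dsumD -dsumZ -bE -(zsum c) // zw scaleNr scalerA -exprS subrr.
  have [e eE] := H _ _ (ltn_ord (tag p)) (ltn_ord (tagged p)).
  rewrite -(subrK (z * b (tag p) (tagged p)) (a _ _)) eE exprSr mulrA.
  apply: (@submoduleD A A^o _ Aloc); last rewrite mulrC;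
    exact: (@submoduleZ A A^o _ Aloc).
have [k [b [kE bB]]] := quotient_basis_extend Aloc (multiples_ideal 1)
  (power_image_submodule M j.+1) KK NK uB gB.
have cS : #|{: S}| = (\sum_(i < d) m i)%N.
  rewrite -sum1_card -[LHS](dsum_sig d m (fun _ _ => 1%N)).
  by apply: eq_bigr => i _; rewrite sum1_card card_ord.
rewrite cS card_ord in kE.
have mr : (\sum_(i < d) m i <= r)%N by rewrite -kE leq_addr.
have {kE} kE : k = (r - \sum_(i < d) m i)%N by rewrite -kE addKn.
subst k; have [bP bG bI] := bB.
set k := (r - _)%N in b bP bG bI bB *.
(* The correction: if [b i = z ^+ j *: w], subtract from [w] the combination of the [v] given by the
   coefficients of [z ^+ j.+1 *: w]. The difference is killed by [z ^+ j.+1]. *)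
have {bP} [x [al [bE xk]]] : exists (x : 'I_k -> M) (al : 'I_k -> nat -> nat -> A),
    (forall i, b i = z ^+ j *: x i + dsum d m (fun l t => al i l t *: (z ^+ j *: v l t)))
    /\ (forall i, z ^+ j.+1 *: x i = 0).
  suff /boolp.choice[f fP] : forall i, exists p : M * (nat -> nat -> A),
      b i = z ^+ j *: p.1 + dsum d m (fun l t => p.2 l t *: (z ^+ j *: v l t)) /\
      z ^+ j.+1 *: p.1 = 0.
    by exists (fun i => (f i).1), (fun i => (f i).2); split=> i; case: (fP i).
  move=> i; have [w bw] := bP (inr i); have [a aE] := vG w.
  exists (w - dsum d m (fun l t => a l t *: v l t), a) => /=.
  rewrite !scalerBr !dsumZ; split.
    rewrite bw (eq_dsum (G := fun l t => a l t *: (z ^+ j *: v l t))) ?subrK //.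
    by move=> *; rewrite !scalerA mulrC.
  rewrite aE (eq_dsum (G := fun l t => a l t *: (z ^+ j.+1 *: v l t))) ?subrr //.
  by move=> *; rewrite !scalerA mulrC.
have [v0 v0E] := ord_fun_extend 0 x.
exists v0; split=> //; split.
- move=> [|i] t id tm.
    rewrite addn0; have tk : (t < k)%N := tm; rewrite (v0E (Ordinal tk)) xk //.
  by rewrite addnS -addSn; exact: vk.
(* The remainder in [z^(j+1) M] expands on the [z ^+ j.+1 *: v], whence the terms [z * e i' t];
   replacing [b] by [x] produces the terms in [al]. *)
- move=> w; have [c [w' cN]] := bG _ (ex_intro _ w erefl).
  have [e eE] := vG w'.
  have [cs csE] := sig_fun_extend 0 (fun p => c (inl p)).
  have [ck ckE] := ord_fun_extend 0 (fun i => c (inr i)).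
  exists (fun i t => if i is i'.+1 then
    (cs i' t + \sum_x c (inr x) * al x i' t) + z * e i' t else ck t).
  move/eqP: cN; rewrite subr_eq eE big_sumType /= => /eqP ->.
  have -> : \sum_p c (inl p) *: u p = dsum d m (fun i t => cs i t *: (z ^+ j *: v i t)).
    by rewrite dsum_sig; apply: eq_bigr => p _; rewrite csE.
  under eq_bigr => i _ do rewrite bE scalerDr.
  rewrite big_split /= -dsum_sumZ dsum_recl -/k /= addrA addrCA; congr (_ + _).
    by apply: eq_bigr => i _; rewrite ckE v0E.
  rewrite -!dsumD; apply: eq_dsum => i t _ _.
  by rewrite !scalerDl -addrA addrC exprS !scalerA mulrA [e i t * z]mulrC.
- move=> a; rewrite dsum_recl -/k /= => a0.
  have a0b : \sum_(i < k) a 0 i *: b i + dsum d m (fun i t =>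
      (a i.+1 t - \sum_(l < k) a 0 l * al l i t) *: (z ^+ j *: v i t)) = 0.
    rewrite -[RHS]a0; under [X in X + _ = _]eq_bigr => i _ do rewrite bE scalerDr.
    rewrite big_split /= -dsum_sumZ -addrA -dsumD; congr (_ + _).
      by apply: eq_bigr => i _; rewrite v0E.
    by apply: eq_dsum => i t _ _; rewrite -scalerDl addrC subrK.
  have cI : forall q : S + 'I_k, multiples 1 (match q with
      inl p => a (tag p).+1 (tagged p) - \sum_(l < k) a 0 l * al l (tag p) (tagged p)
      | inr i => a 0 i end).
    apply: bI; rewrite big_sumType /=.
    rewrite (_ : \sum_p _ = dsum d m (fun i t =>
      (a i.+1 t - \sum_(l < k) a 0 l * al l i t) *: (z ^+ j *: v i t))).
      by rewrite addrC a0b; exact: submodule0 (power_image_submodule _ _).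
    by rewrite dsum_sig.
  have ak0 (i : 'I_k) : multiples 1 (a 0 i) := cI (inr i).
  have aS i t : (i < d)%N -> (t < m i)%N -> multiples 1 (a i.+1 t).
    move=> id tm; have := cI (inl (existT _ (Ordinal id) (Ordinal tm))) => /= /(
      @submoduleD A A^o _ (multiples_ideal 1)) H.
    rewrite -(subrK (\sum_(l < k) a 0 l * al l i t) (a i.+1 t)); apply: H.
    elim/big_ind: _ => [|x1 x2|l _].
    + exact: (@submodule0 A A^o _ (multiples_ideal 1)).
    + exact: (@submoduleD A A^o _ (multiples_ideal 1)).
    + by rewrite mulrC; apply: (@submoduleZ A A^o _ (multiples_ideal 1)).
  move=> [|i] t; first by move=> _ tk; exact: (ak0 (Ordinal tk)).
  (* All coefficients are divisible by [z]. Moving this factor to the vectors kills the terms in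
     [v0] and leaves a relation at level [j.+1], so the quotients [e i t] lie in [multiples i.+1]
     and one more power of [z] is gained. *)
  have [e eE] : exists e : nat -> nat -> A, forall i t, (i < d)%N -> (t < m i)%N ->
      a i.+1 t = e i t * z.
    suff /boolp.choice[e eE] : forall p : nat * nat, exists e,
        (p.1 < d)%N -> (p.2 < m p.1)%N -> a p.1.+1 p.2 = e * z.
      by exists (fun i t => e (i, t)) => l s; exact: (eE (l, s)).
    move=> [l s] /=; have [ld|] := ltnP l d; last by exists 0.
    have [sm|] := ltnP s (m l); last by exists 0.
    by have [e ->] := aS _ _ ld sm; exists e.
  have : dsum d m (fun i t => e i t *: (z ^+ j.+1 *: v i t)) = 0.
    rewrite -[RHS]a0 big1 ?add0r => [|l _].
      by apply: eq_dsum => l s ld sm; rewrite eE // exprS !scalerA mulrA.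
    have [f ->] := ak0 l.
    by rewrite v0E scalerA -mulrA -exprD add1n -scalerA xk scaler0.
  move/vI => H id tm; have [f fE] := H i t id tm.
  by exists f; rewrite eE // fE -mulrA -exprSr.
Qed.

(** Descending induction on [j] from the empty family at [j = n]. Each step adds as many generators
    as the rank drops, so the multiplicities telescope to [r j]; [adapted_step] also shows that the
    ranks decrease, which makes the truncated subtraction exact. *)
Lemma adapted_of_graded_bases (M : lmodType A) n (r : nat -> nat) :
  local_ring A -> nonunits z -> z ^+ n = 0 ->
  (forall j, (n <= j)%N -> r j = 0%N) ->
  (forall j, (j < n)%N -> exists g : 'I_(r j) -> M, graded_basis j g) ->
  exists v : nat -> nat -> M, adapted 0 n (fun i => r i - r i.+1)%N v.
Proof.
move=> Aloc zN zn rn rB.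
suff H d j : (j + d)%N = n ->
    (\sum_(i < d) (r (j + i) - r (j + i).+1) = r j)%N /\
    exists v : nat -> nat -> M, adapted j d (fun i => r (j + i) - r (j + i).+1)%N v.
  by have [_] := H n 0%N erefl.
elim: d j => [|d IHd] j jd.
  split; first by rewrite big_ord0 rn // -jd addn0.
  exists (fun _ _ => 0); split=> // w.
  by exists (fun _ _ => 0); rewrite /dsum big_ord0 -[j]addn0 jd zn scale0r.
have [rE [v vA]] := IHd j.+1 (etrans (addSnnS _ _) jd).
have jn : (j < n)%N by rewrite -jd addnS ltnS leq_addr.
have [g gB] := rB j jn.
have [v0] := adapted_step Aloc zN vA gB; rewrite rE => -[mr v0A].
have mE : (fun i => if i is i'.+1 then r (j.+1 + i') - r (j.+1 + i').+1
    else r j - r j.+1)%N = (fun i => r (j + i) - r (j + i).+1)%N.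
  by apply/funext => -[|i]; rewrite ?addn0 // addSnnS.
split; last by rewrite -mE; exists (fun i => if i is i'.+1 then v i' else v0).
rewrite big_ord_recl /= addn0.
rewrite (eq_bigr (fun i : 'I_d => r (j.+1 + i) - r (j.+1 + i).+1)%N) ?rE ?subnK //.
by move=> i _; rewrite /bump add1n addSnnS.
Qed.

End AdaptedFamily.

(** * Quasi free modules *)

Section QuasiFreeFamily.
Context (A : nzRingType) (I : set A) (m : nat -> nat).
Implicit Types (a b : nat -> nat -> A).

(** The coefficient index [i] refers to the summand [A / I^(i+1)], the convention of [adapted]. *)
Fixpoint qf_elt (n : nat) a : quasi_free_module I m n :=
  match n return quasi_free_module I m n with
  | 0 => [ffun=> 0] : {ffun 'I_0 -> A^o}
  | i.+1 => (qf_elt i a,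
     [ffun k : 'I_(m i.+1) => quo_class (power_submod I i.+1) (a i k)])
  end.

Lemma qf_elt_eq n a b : qf_elt n a = qf_elt n b <->
  forall i k, (i < n)%N -> (k < m i.+1)%N -> ideal_exp I i.+1 (a i k - b i k).
Proof.
elim: n => [|n [IHn1 IHn2]] /=; first by split=> // _; apply/ffunP => -[].
split=> [[/IHn1 H /ffunP ab] i k|H].
  rewrite ltnS leq_eqVlt => /orP[/eqP-> km|]; last exact: H.
  by have := ab (Ordinal km); rewrite !ffunE => /quo_classP.
congr pair; first by apply: IHn2 => i k ik; apply: H; exact: leqW.
by apply/ffunP => k; rewrite !ffunE; apply/quo_classP; apply: H.
Qed.

Lemma qf_elt_surj n q : exists a, qf_elt n a = q.
Proof.
elim: n q => [|n IHn] /= q; first by exists (fun _ _ => 0); apply/ffunP => -[].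
case: q => q h; have [a aq] := IHn q.
have [b bE] := ord_fun_extend 0 (fun k => quo_repr (h k) : A).
exists (fun i k => if i == n then b k else a i k); congr pair; last first.
  by apply/ffunP => k; rewrite ffunE eqxx bE quo_reprK.
rewrite -aq; apply/qf_elt_eq => i k ltin _.
by rewrite ltn_eqF // subrr; exact: (@submodule0 A A^o _ (ideal_expP I _)).
Qed.

Lemma qf_elt_linear n x a b :
  qf_elt n (fun i k => x * a i k + b i k) = x *: qf_elt n a + qf_elt n b.
Proof.
elim: n => [|n IHn] /=; first by apply/ffunP => -[].
rewrite IHn; congr pair; apply/ffunP => k; rewrite !ffunE.
exact: (quo_class_linear (power_submod I n.+1)).
Qed.

Lemma qf_elt0 n : qf_elt n (fun _ _ => 0) = 0.
Proof.
have := qf_elt_linear n (-1) (fun _ _ => 0) (fun _ _ => 0).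
by rewrite scaleN1r addNr mulr0 addr0.
Qed.

Definition qf_gen n (i k : nat) : quasi_free_module I m n :=
  qf_elt n (fun i' k' => ((i' == i) && (k' == k))%:R).

Lemma qf_elt_dsum n a :
  qf_elt n a = dsum n (fun i => m i.+1) (fun i k => a i k *: qf_gen n i k).
Proof.
rewrite dsum_sig.
have sumE (T : Type) (s : seq T) (c : T -> A) (f : T -> nat -> nat -> A) :
    \sum_(p <- s) c p *: qf_elt n (f p) = qf_elt n (fun i k => \sum_(p <- s) c p * f p i k).
  elim: s => [|p s IHs].
    rewrite big_nil -(qf_elt0 n); congr qf_elt.
    by apply/funext => i; apply/funext => k; rewrite big_nil.
  rewrite big_cons IHs -qf_elt_linear; congr qf_elt.
  by apply/funext => i; apply/funext => k; rewrite big_cons.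
rewrite sumE; apply/qf_elt_eq => i k ltin ltkm.
rewrite (bigD1 (existT (fun i : 'I_n => 'I_(m i.+1)) (Ordinal ltin) (Ordinal ltkm))) //=.
rewrite !eqxx mulr1 big1 ?addr0 ?subrr; first exact: (@submodule0 A A^o _ (ideal_expP I i.+1)).
move=> -[i' k'] /= neq; case: eqP => [ii|]; last by rewrite /= mulr0.
case: eqP => [kk|]; last by rewrite /= mulr0.
case/eqP: neq; have ii' : i' = Ordinal ltin by apply: val_inj.
by subst i'; congr existT; apply: val_inj.
Qed.

(** Trades the iterated product for generators with prescribed relations, the form in which
    [adapted] families appear. *)
Lemma quasi_freeP n (M : lmodType A) : quasi_free I n m M <->
  exists v : nat -> nat -> M,
    (forall w, exists a, w = dsum n (fun i => m i.+1) (fun i k => a i k *: v i k)) /\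
    (forall a, dsum n (fun i => m i.+1) (fun i k => a i k *: v i k) = 0 <->
       forall i k, (i < n)%N -> (k < m i.+1)%N -> ideal_exp I i.+1 (a i k)).
Proof.
have qf_elt_eq0 a : qf_elt n a = 0 <->
    forall i k, (i < n)%N -> (k < m i.+1)%N -> ideal_exp I i.+1 (a i k).
  rewrite -(qf_elt0 n) qf_elt_eq.
  by split=> H i k li lk; have := H i k li lk; rewrite subr0.
split=> [[f [g fK gK]]|[v [vG vI]]].
  have fdsum a : f (dsum n (fun i => m i.+1) (fun i k => a i k *: g (qf_gen n i k))) =
      qf_elt n a.
    rewrite qf_elt_dsum !dsum_sig linear_sum; apply: eq_bigr => p _.
    by rewrite linearZ /= gK.
  exists (fun i k => g (qf_gen n i k)); split=> [w|a].
    by have [a aE] := qf_elt_surj (f w); exists a; apply: (can_inj fK); rewrite fdsum.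
  rewrite -qf_elt_eq0 -fdsum; split=> [->|]; first exact: linear0.
  by rewrite -(linear0 f); exact: (can_inj fK).
have [c cE] := boolp.choice vG.
(* The chosen coefficients need not be linear in [w], but their classes are independent of the
   choice. *)
have cP a w : w = dsum n (fun i => m i.+1) (fun i k => a i k *: v i k) ->
    qf_elt n (c w) = qf_elt n a.
  move=> wE; apply/qf_elt_eq; apply/(vI (fun i k => c w i k - a i k)).
  rewrite (eq_dsum (G := fun i k => c w i k *: v i k + (-1) *: (a i k *: v i k))).
    by rewrite dsumD -dsumZ -wE -cE scaleN1r subrr.
  by move=> i k _ _; rewrite scaleN1r scalerBl.
pose f w := qf_elt n (c w).
have flin : linear f.
  move=> x u w; rewrite -qf_elt_linear; apply: cP.
  rewrite [in LHS](cE u) [in LHS](cE w) dsumZ -dsumD; apply: eq_dsum => i k _ _.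
  by rewrite scalerDl scalerA.
pose L : {linear M -> quasi_free_module I m n} :=
  HB.pack f (GRing.isLinear.Build A M (quasi_free_module I m n) _ f flin).
have /boolp.choice[h hE] := @qf_elt_surj n.
exists L; exists (fun q => dsum n (fun i => m i.+1) (fun i k => h q i k *: v i k)) => [w|q].
  rewrite {2}(cE w) /=; apply/eqP; rewrite -subr_eq0; apply/eqP.
  have /qf_elt_eq/(vI (fun i k => h (f w) i k - c w i k)) := hE (f w).
  rewrite (eq_dsum (G := fun i k => h (f w) i k *: v i k + (-1) *: (c w i k *: v i k))).
    by rewrite dsumD -dsumZ scaleN1r.
  by move=> i k _ _; rewrite scaleN1r scalerBl.
by rewrite /= /f (cP _ _ erefl).
Qed.

End QuasiFreeFamily.

Lemma dsum_split (V : nmodType) d e m (F : nat -> nat -> V) :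
  dsum (d + e) m F = dsum d m F + dsum e (fun i => m (d + i)%N) (fun i => F (d + i)%N).
Proof. by rewrite /dsum big_split_ord. Qed.

(** * Quasi free modules and graded bases for a principal ideal *)

Section PrincipalIdeal.
Context (A : comNzRingType) (I : set A) (z : A) (Iz : I = multiples z 1).

Lemma ideal_exp_principal j : ideal_exp I j = multiples z j.
Proof.
elim: j => [|j IHj]; first by apply/seteqP; split=> // a _; exists a; rewrite mulr1.
have -> : ideal_exp I j.+1 = ideal_mul I (ideal_exp I j) by [].
rewrite IHj Iz; apply/seteqP; split.
  apply: smallest_sub; first exact: multiples_ideal.
  by move=> _ [_ [a ->] [_ [b ->] <-]]; exists (a * b); rewrite mulrACA -exprD.
move=> _ [a ->]; apply: sub_gen_smallest; exists z; first by exists 1; rewrite mul1r.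
by exists (a * z ^+ j); [exists a|rewrite mulrCA -exprS].
Qed.

Lemma ideal_scale_principal (M : lmodType A) j :
  ideal_scale (ideal_exp I j) [set: M] = power_image z j.
Proof.
rewrite ideal_exp_principal; apply/seteqP; split.
  apply: smallest_sub; first exact: power_image_submodule.
  by move=> _ [_ [b ->] [w _ <-]]; exists (b *: w); rewrite scalerA mulrC.
move=> _ [w ->]; apply: sub_gen_smallest; exists (z ^+ j); last by exists w.
by exists 1; rewrite mul1r.
Qed.

(** An adapted family at [j = 0] generates all of [M]. Ranks are indexed from 0 and types from 1,
    whence the [i.-1]. *)
Lemma quasi_free_of_graded_bases (M : lmodType A) n (r : nat -> nat) :
  local_ring A -> ~ I 1 -> z ^+ n = 0 ->
  (forall j, (n <= j)%N -> r j = 0%N) ->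
  (forall j, (j < n)%N -> exists g : 'I_(r j) -> M, graded_basis z j g) ->
  quasi_free I n (fun i => r i.-1 - r i)%N M.
Proof.
move=> Aloc I1 zn rn rB.
have zN : nonunits z.
  by move=> [y [_ yz]]; apply: I1; rewrite Iz; exists y; rewrite expr1 yz.
have [v [vk vG vI]] := adapted_of_graded_bases Aloc zN zn rn rB.
have dsumE (a : nat -> nat -> A) : dsum n (fun i => r i - r i.+1)%N
    (fun i k => a i k *: (z ^+ 0 *: v i k)) =
    dsum n (fun i => r i - r i.+1)%N (fun i k => a i k *: v i k).
  by apply: eq_dsum => i k _ _; rewrite scale1r.
apply/quasi_freeP; exists v; split=> [w|a].
  by have [a aE] := vG w; exists a; rewrite -dsumE -aE scale1r.
rewrite -dsumE; split=> [a0 i k li lk|aI].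
  by rewrite ideal_exp_principal; exact: vI.
rewrite (eq_dsum (G := fun _ _ => 0)); first by apply: big1 => i _; exact: big1.
move=> i k li lk; have := aI i k li lk.
rewrite ideal_exp_principal => -[b ->].
by rewrite expr0 scale1r -scalerA (vk i k) // scaler0.
Qed.

(** The summands [A / z^(i+1)] with [i < j] are killed by [z ^+ j]; each of the others contributes
    one basis vector, whose independence over [A / I] is the hypothesis on [z]. *)
Lemma graded_basis_of_quasi_free (M : lmodType A) n m j :
  (forall a, multiples z j.+1 (a * z ^+ j) -> z ^+ j = 0 \/ I a) ->
  (j < n)%N -> quasi_free I n m M ->
  exists (r : nat) (g : 'I_r -> M), graded_basis z j g.
Proof.
move=> zD jn /quasi_freeP[v [vG vI]].
suff [T [g gB]] : exists (T : finType) (g : T -> M), graded_basis z j g.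
  exists #|T|, (g \o @enum_val T predT).
  exact: (quotient_basis_reindex (@enum_val_bij T) gB).
(* When [z ^+ j = 0] the graded piece is zero and the empty family is a basis. *)
have [z0|z0] := pselect (z ^+ j = 0).
  exists 'I_0, (fun _ => 0); split=> [[] //|_ [w ->]|c _ []//].
  exists (fun=> 0); exists 0; rewrite z0 big_ord0 scale0r scaler0 subrr //.
pose d := (n - j)%N; have nE : n = (j + d)%N by rewrite subnKC // ltnW.
pose T := {i : 'I_d & 'I_(m (j + i).+1)} : finType.
have Tsum (a : nat -> nat -> A) (c : T -> A) : (forall p : T, a (tag p) (tagged p) = c p) ->
    \sum_p c p *: (z ^+ j *: v (j + tag p)%N (tagged p)) =
    dsum d (fun i => m (j + i).+1) (fun i k => a i k *: (z ^+ j *: v (j + i)%N k)).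
  by move=> ac; rewrite dsum_sig; apply: eq_bigr => p _; rewrite ac.
(* The family of coefficients equal to [z ^+ i.+1] at [(i, k)] and 0 elsewhere satisfies the
   criterion for a relation. *)
have vkill i k : (i < n)%N -> (k < m i.+1)%N -> z ^+ i.+1 *: v i k = 0.
  move=> li lk; rewrite -[LHS](_ : dsum n (fun i => m i.+1)
      (fun i' k' => (if (i' == i) && (k' == k) then z ^+ i.+1 else 0) *: v i' k') = _).
    apply/vI => i' k' _ _; rewrite ideal_exp_principal.
    case: eqP => [->|_] /=; last by exists 0; rewrite mul0r.
    by case: eqP => _; [exists 1; rewrite mul1r|exists 0; rewrite mul0r].
  rewrite /dsum (bigD1 (Ordinal li)) //= (bigD1 (Ordinal lk)) //= !eqxx big1.
    rewrite addr0 big1 ?addr0 // => i' neq; apply: big1 => k' _.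
    rewrite ifF ?scale0r //; apply/negbTE; apply: contra neq => /andP[/eqP ii _].
    by apply/eqP/val_inj.
  move=> k' neq; rewrite ifF ?scale0r //; apply/negbTE.
  by apply: contra neq => /eqP kk; apply/eqP/val_inj.
exists T, (fun p : T => v (j + tag p)%N (tagged p)); split=> [p|_ [w ->]|c [w wE]].
- by exists (v (j + tag p)%N (tagged p)).
- have [a aE] := vG w; exists (fun p : T => a (j + tag p)%N (tagged p)); exists 0.
  rewrite (Tsum (fun i k => a (j + i)%N k)) // scaler0 [in X in X - _]aE dsumZ.
  rewrite [in X in X - _]nE dsum_split.
  rewrite [X in X + _ - _](_ : _ = 0) ?add0r; last first.
    apply: big1 => i _; apply: big1 => k _; rewrite scalerA mulrC -scalerA.
    have -> : z ^+ j = z ^+ (j - i.+1) * z ^+ i.+1 by rewrite -exprD subnK.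
    rewrite -[X in _ *: X]scalerA vkill ?scaler0 //.
    exact: ltn_trans jn.
  apply/eqP; rewrite subr_eq0; apply/eqP; apply: eq_dsum => i k _ _.
  by rewrite !scalerA mulrC.
- move=> p; have [a ac] := @sig_fun_extend _ 0 d (fun i => m (j + i).+1) c.
  rewrite -ac; have [b bE] := vG w.
  (* Moving [z ^+ j.+1 *: w] to the left gives a relation on all generators; its coefficient at
     [j + tag p] puts [c p * z ^+ j] in [multiples z j.+1]. *)
  have wE' : dsum n (fun i => m i.+1) (fun i k =>
     ((if (i < j)%N then 0 else a (i - j)%N k * z ^+ j) - b i k * z ^+ j.+1) *: v i k) = 0.
    rewrite (eq_dsum (G := fun i k => (if (i < j)%N then 0 else a (i - j)%N k * z ^+ j) *: v i k
      + (- z ^+ j.+1) *: (b i k *: v i k))).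
      rewrite dsumD -dsumZ -bE scaleNr -wE (Tsum a) // nE dsum_split.
      apply/eqP; rewrite subr_eq0; apply/eqP.
      rewrite [X in X + _](_ : _ = 0) ?add0r; last first.
        by apply: big1 => i _; apply: big1 => k _; rewrite ltn_ord scale0r.
      apply: eq_dsum => i k _ _.
      by rewrite ifF ?scalerA ?addKn // ltnNge leq_addr.
    by move=> i k _ _; rewrite scalerBl scaleNr scalerA [b i k * _]mulrC.
  have li : (j + tag p < n)%N by rewrite nE ltn_add2l.
  have := (vI _).1 wE' _ _ li (ltn_ord (tagged p)).
  rewrite ideal_exp_principal ltnNge leq_addr /= addKn => -[e eE].
  rewrite -Iz; have [|//|//] := zD (a (tag p) (tagged p)).
  exists (e * z ^+ tag p + b (j + tag p)%N (tagged p)).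
  have jS : (tag p + j.+1 = (j + tag p).+1)%N by rewrite addnS addnC.
  by rewrite mulrDl -mulrA -exprD jS -eE subrK.
Qed.

End PrincipalIdeal.

(** * Graded pieces of sheaves *)

(** The default value 0 makes this total in [y]: that [z ^+ j *: w] belongs to [I^j E] is known only
    where [z] generates [I]. *)
Definition power_lift (k : fieldType) (X : ringed_space k) (I : ideal_sheaf X)
    (E : module_sheaf X) (j : nat) (y : X) (z : stalk y) (w : E y) : sub_power I E j y :=
  insubd 0 (z ^+ j *: w).

Section GradedStalk.
Context (k : fieldType) (X : ringed_space k) (I : ideal_sheaf X).
Context (E : module_sheaf X) (j : nat) (x : subscheme I).
Implicit Types (a : stalk (val x)) (u : sub_power I E j (val x)).

Lemma gr_scaleE a u : (sub_class a : stalk x) *: gr_class u = gr_class (a *: u).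
Proof.
rewrite /gr_class linearZ /=.
exact: (@oq_scaleE _ _ _ _ (@gr_killed _ _ _ _ _ x)).
Qed.

Lemma gr_class0 : gr_class (0 : sub_power I E j (val x)) = 0.
Proof. by rewrite /gr_class linear0. Qed.

Lemma gr_scale_sum (T : finType) (c : T -> stalk (val x)) (u : T -> sub_power I E j (val x)) :
  \sum_t (sub_class (c t) : stalk x) *: gr_class (u t) = gr_class (\sum_t c t *: u t).
Proof.
rewrite [RHS]linear_sum; apply: eq_bigr => t _; exact: gr_scaleE.
Qed.

Lemma sub_class_surj (c : stalk x) : exists a, sub_class a = c.
Proof. by exists (qr_repr c); exact: qr_reprK. Qed.

Lemma gr_class_surj (v : gr_stalk E j x) : exists u, gr_class u = v.
Proof. by exists (quo_repr v); exact: quo_reprK. Qed.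

Definition gr_basis r (e : 'I_r -> gr_stalk E j x) : Prop :=
  forall v : gr_stalk E j x, exists! c : {ffun 'I_r -> stalk x}, v = \sum_t c t *: e t.

Context (z : stalk (val x)) (Iz : I (val x) = multiples z 1).

Lemma power_scaleE e (w : E (val x)) : power_scale I E e (val x) w <-> power_image z e w.
Proof. by rewrite /power_scale /= (ideal_scale_principal Iz). Qed.

Lemma val_power_lift (w : E (val x)) :
  val (power_lift I j z w) = z ^+ j *: w.
Proof. by rewrite /power_lift insubdK //; apply/asboolP/power_scaleE; exists w. Qed.

(** Unique coordinates in the quotient ring become coefficients in the ambient stalk determined
    modulo [I]. *)
Lemma gr_basis_graded_basis r (w : 'I_r -> E (val x)) :
  gr_basis (fun t => gr_class (power_lift I j z (w t))) <-> graded_basis z j w.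
Proof.
pose g t : sub_power I E j (val x) := power_lift I j z (w t).
have vg (c : 'I_r -> stalk (val x)) : val (\sum_t c t *: g t) = \sum_t c t *: (z ^+ j *: w t).
  by rewrite raddf_sum; apply: eq_bigr => t _; rewrite -val_power_lift.
have gE (c : {ffun 'I_r -> stalk x}) (a : 'I_r -> stalk (val x)) :
    (forall t, sub_class (a t) = c t) ->
    \sum_t c t *: gr_class (g t) = gr_class (\sum_t a t *: g t).
  by move=> ac; rewrite -gr_scale_sum; apply: eq_bigr => t _; rewrite ac.
split=> [H|[_ gG gI]].
  split=> [t|v [u vE]|a aN t]; first by exists (w t).
    have [c [cE _]] := H (gr_class (power_lift I j z u)).
    have /boolp.choice[a aE] t := sub_class_surj (c t).
    exists a; apply/power_scaleE; rewrite -vg vE -val_power_lift.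
    by apply/gr_classP; rewrite -(gE c).
  (* Independence is the uniqueness of the coordinates of 0, applied to the classes of [a] and to
     the zero family. *)
  rewrite -Iz; have [c [_ cU]] := H 0.
  have a0 : 0 = \sum_t [ffun t => sub_class (a t) : stalk x] t *: gr_class (g t).
    rewrite (gE _ a) => [|s]; last by rewrite ffunE.
    rewrite -gr_class0; apply/gr_classP; rewrite vg linear0 sub0r.
    by apply: (submoduleN (submodP (power_scale I E j.+1 (val x)))); apply/power_scaleE.
  have c0 : 0 = \sum_t [ffun t => 0 : stalk x] t *: gr_class (g t).
    rewrite (gE _ (fun=> 0)) => [|s]; last first.
      by rewrite ffunE /sub_class /qr_class raddf0.
    rewrite -gr_class0; congr gr_class; apply: val_inj; rewrite vg linear0.
    by rewrite big1 // => s _; rewrite scale0r.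
  have /ffunP/(_ t) := etrans (esym (cU _ a0)) (cU _ c0).
  rewrite !ffunE => aE; rewrite -[a t]subr0; apply/sub_classP.
  by rewrite aE /sub_class /qr_class raddf0.
move=> v; have [u <-] := gr_class_surj v.
have /asboolP/power_scaleE/gG[a aN] := valP u.
exists [ffun t => sub_class (a t)]; split.
  rewrite (gE _ a) => [|s]; last by rewrite ffunE.
  by apply/gr_classP; rewrite vg; apply/power_scaleE.
move=> c; have /boolp.choice[b bE] t := sub_class_surj (c t).
rewrite (gE _ b) // => /gr_classP/power_scaleE; rewrite vg => bN.
apply/ffunP => t; rewrite ffunE -bE; apply/sub_classP; rewrite Iz.
apply: (gI (fun t => a t - b t)).
under eq_bigr => s _ do rewrite scalerBl.
rewrite sumrB -(subrKA (val u)) [X in power_image _ _ X]addrC -[X in _ + X]opprB.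
exact: (submoduleB (power_image_submodule z (E (val x)) j.+1) bN aN).
Qed.

Lemma graded_basis_exists r (e : 'I_r -> gr_stalk E j x) :
  gr_basis e -> exists w : 'I_r -> E (val x), graded_basis z j w.
Proof.
move=> eB; have [w wE] : exists w : 'I_r -> E (val x),
    forall t, e t = gr_class (power_lift I j z (w t)).
  suff /boolp.choice[w wE] : forall t, exists w : E (val x),
      e t = gr_class (power_lift I j z w) by exists w.
  move=> t; have [u <-] := gr_class_surj (e t).
  have /asboolP/power_scaleE[w uw] := valP u.
  by exists w; rewrite /power_lift -uw valKd.
by exists w; apply/gr_basis_graded_basis; rewrite -(funext wE).
Qed.

End GradedStalk.

(** A converse of [near_support]: open sets of the subspace are traces of open sets of [X]. *)
Lemma near_subscheme (k : fieldType) (X : ringed_space k) (J : ideal_sheaf X)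
    (x : subscheme J) (P : subscheme J -> Prop) :
  (\forall y \near x, P y) ->
  \forall y \near val x, forall y' : subscheme J, val y' = y -> P y'.
Proof.
rewrite {1}/prop_near1 nbhsE => -[B [oB Bx] BP].
have [A oA AB] : exists2 A : set X, open A & (val : subscheme J -> X) @^-1` A = B.
  by case: oB => A oA AB; exists A.
have Ax : A (val x) by move: Bx; rewrite -AB.
near=> y => y' yy; apply: BP; rewrite -AB /= yy.
by near: y; exact: open_nbhs_nbhs.
Unshelve. all: by end_near. Qed.

(** The type depends only on the ranks, which are constant near [x]; the generator of the ideal is
    chosen separately in each stalk. *)
Lemma quasi_locally_free_of_graded (k : fieldType) (X : ringed_space k)
    (I : ideal_sheaf X) (E : module_sheaf X) (n : nat) :
  (forall y : X, [/\ local_ring (stalk y), ~ I y 1 &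
     exists2 z, I y = multiples z 1 & z ^+ n = 0]) ->
  (forall j, (j < n)%N -> locally_free (graded_piece I E j)) ->
  quasi_locally_free E I n.
Proof.
move=> XI gr_free x.
have Isupp (y : X) : exists y' : subscheme I, val y' = y.
  have [_ I1 _] := XI y.
  by exists (exist _ y (mem_set (I1 : Defs.support I y))).
have [x' xx'] := Isupp x.
have /boolp.choice[r rP] (j : nat) : exists r, (j < n)%N ->
    \forall y \near x', exists e : 'I_r -> gr_stalk E j y, gr_basis e.
  have [jn|] := ltnP j n; last by exists 0%N.
  have [r [e eP]] := gr_free j jn x'; exists r => _.
  by apply: filterS eP => y [_ yU]; exists (fun t => e t y).
(* With rank 0 from [n] on, the last multiplicity, that of [A / I^n], is the whole rank [r n.-1]. *)
pose r' j := if (j < n)%N then r j else 0%N.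
exists (fun i => r' i.-1 - r' i)%N.
have : \forall y \near x', forall j : 'I_n, exists e : 'I_(r j) -> gr_stalk E j y, gr_basis e.
  exact: (@filter_forall _ 'I_n (fun j => [set y | exists e : 'I_(r j) -> gr_stalk E j y,
    gr_basis e]) (nbhs x') _ (fun j => rP j (ltn_ord j))).
move=> /near_subscheme; rewrite xx'; apply: filterS => y yP.
have [yloc I1 [z Iz zn]] := XI y.
apply: (quasi_free_of_graded_bases Iz yloc I1 zn) => j.
  by rewrite /r' leqNgt => /negPf ->.
move=> jn; rewrite /r' jn; have [y' yy'] := Isupp y; subst y.
by have [e /(graded_basis_exists Iz)] := yP y' erefl (Ordinal jn).
Qed.

(** * Operations on local sections *)

Section LocalSections.
Context (k : fieldType) (X : ringed_space k) (E : module_sheaf X).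
Implicit Types x : X.

Lemma section_exists x (a : stalk x) : exists2 s, section_at x s & s x = a.
Proof. by have [_ _] := section_etale X; exact. Qed.

Lemma msection_exists x (v : E x) : exists2 s, msection_at x s & s x = v.
Proof. by have [_ _] := msection_etale E; exact. Qed.

Lemma msection_eq_near x (s t : forall y, E y) : msection_at x s -> msection_at x t ->
  s x = t x -> \forall y \near x, s y = t y.
Proof. by have [_ H _] := msection_etale E; move=> xs xt st; apply/(H x s t xs). Qed.

Lemma section_exp x (s : forall y : X, stalk y) e :
  section_at x s -> section_at x (fun y => s y ^+ e).
Proof.
move=> xs; elim: e => [|e IHe].
  have := sectionC x 1; congr section_at.
  by apply: functional_extensionality_dep => y; rewrite expr0 scale1r.
have := sectionM xs IHe; congr section_at.
by apply: functional_extensionality_dep => y; rewrite exprS.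
Qed.

Lemma msection0 x : msection_at x (fun y => 0 : E y).
Proof.
have [s xs _] := msection_exists (0 : E x).
have := msectionZ (sectionC x 0) xs; congr msection_at.
by apply: functional_extensionality_dep => y; rewrite !scale0r.
Qed.

Lemma msection_sum x (T : finType) (s : T -> forall y, E y) :
  (forall t, msection_at x (s t)) -> msection_at x (fun y => \sum_t s t y).
Proof.
move=> xs; elim: (index_enum T) => [|t r IHr].
  have := msection0 x; congr msection_at.
  by apply: functional_extensionality_dep => y; rewrite big_nil.
have := msectionD (xs t) IHr; congr msection_at.
by apply: functional_extensionality_dep => y; rewrite big_cons.
Qed.

End LocalSections.

(** * Spreading graded bases to a neighbourhood *)

Section GradedLocallyFree.
Context (k : fieldType) (X : ringed_space k) (I : ideal_sheaf X) (E : module_sheaf X).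
Context (x : X) (z : forall y : X, stalk y) (xz : section_at x z).
Context (Iz : \forall y \near x, I y = multiples (z y) 1).

(* Generation spreads to a neighbourhood because [E] is of finite type.  Independence
   spreads because the relations between the [z^j w t] and generators of [z^(j+1) E] are
   of finite type, and their coefficients on the [z^j w t] lie in [I] at [x], hence
   near [x]. *)
Lemma graded_basis_near j r (w : 'I_r -> forall y, E y) :
  coherent E -> (forall t, msection_at x (w t)) ->
  graded_basis (z x) j (fun t => w t x) ->
  \forall y \near x, graded_basis (z y) j (fun t => w t y).
Proof.
move=> [Efin Erel] xw [_ wG wI].
have [p [g gP]] := Efin x; have [xg gG] := nbhs_singleton gP.
have Izx := nbhs_singleton Iz.
have [l [R RP]] : exists l (R : 'I_l -> 'I_(r + p) -> forall y : X, stalk y),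
   \forall y \near x, (forall q i, section_at y (R q i)) /\
     forall (c : 'I_r -> stalk y) (b : 'I_p -> stalk y),
       \sum_t c t *: (z y ^+ j *: w t y) = z y ^+ j.+1 *: \sum_q b q *: g q y <->
       exists d : 'I_l -> stalk y, (forall t, c t = \sum_q d q * R q (lshift p t) y) /\
         (forall t, - b t = \sum_q d q * R q (rshift r t) y).
  (* The two families are concatenated to apply [Erel]; the sign of [b] comes from moving the
     right-hand side to the left. *)
  pose e (i : 'I_(r + p)) y := match fintype.split i with
    | inl t => z y ^+ j *: w t y | inr q => z y ^+ j.+1 *: g q y end.
  have [i|l [R RP]] := Erel x _ e.
    by rewrite /e; case: fintype.split => q; apply: msectionZ => //; exact: section_exp.
  exists l, R; apply: filterS RP => y [yR cR]; split=> // c b.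
  pose c' i := match fintype.split i with inl t => c t | inr q => - b q end.
  have -> : \sum_t c t *: (z y ^+ j *: w t y) = z y ^+ j.+1 *: (\sum_q b q *: g q y) <->
      \sum_i c' i *: e i y = 0.
    rewrite big_split_ord /=.
    under [X in _ <-> X + _ = _]eq_bigr => t _ do rewrite /c' /e (unsplitK (inl t)).
    under [X in _ <-> _ + X = _]eq_bigr => q _ do
      rewrite /c' /e (unsplitK (inr q)) scaleNr scalerA mulrC -scalerA.
    rewrite sumrN -scaler_sumr; split=> [->|/eqP]; first by rewrite subrr.
    by rewrite subr_eq0 => /eqP.
  rewrite cR; split=> -[d dP]; exists d.
    split=> t; rewrite -dP /c'; first by rewrite (unsplitK (inl t)).
    by rewrite (unsplitK (inr t)).
  move=> i; rewrite /c' -[in RHS](splitK i); case: (fintype.split i) => t /=; first exact: dP.1.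
  exact: dP.2.
have [xR Rx] := nbhs_singleton RP.
(* Each [R q] is itself a relation, with [d] the indicator of [q], so [wI] applies to it. *)
have RI q t : I x (R q (lshift p t) x).
  rewrite Izx; have /Rx : exists d : 'I_l -> stalk x,
      (forall t, R q (lshift p t) x = \sum_q' d q' * R q' (lshift p t) x) /\
      (forall t, - (- R q (rshift r t) x) = \sum_q' d q' * R q' (rshift r t) x).
    exists (fun q' => (q' == q)%:R); split=> s; rewrite (bigD1 q) //= eqxx mul1r ?opprK;
    by rewrite big1 ?addr0 // => i /negPf ->; rewrite mul0r.
  by move=> eqR; apply: (wI (fun t => R q (lshift p t) x)); eexists; exact: eqR.
have RIy : \forall y \near x, forall q t, I y (R q (lshift p t) y).
  apply: (@filter_forall _ 'I_l (fun q => [set y | forall t, I y (R q (lshift p t) y)])).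
  move=> q; apply: (@filter_forall _ 'I_r (fun t => [set y | I y (R q (lshift p t) y)])).
  by move=> t; apply: ideal_open => //; exact: xR.
(* It is enough to generate the [z ^+ j *: g q], since the [g q] generate [E] near [x]. An
   expression at [x], lifted to sections, remains an equality nearby. *)
have Gy : \forall y \near x, forall q, exists (c : 'I_r -> stalk y) u,
    z y ^+ j *: g q y = \sum_t c t *: (z y ^+ j *: w t y) + z y ^+ j.+1 *: u.
  apply: (@filter_forall _ 'I_p (fun q => [set y | exists (c : 'I_r -> stalk y) u,
    z y ^+ j *: g q y = \sum_t c t *: (z y ^+ j *: w t y) + z y ^+ j.+1 *: u])) => q.
  have [c [u cu]] : exists c, power_image (z x) j.+1 (z x ^+ j *: g q x -
      \sum_(t : 'I_r) c t *: (z x ^+ j *: w t x)) by apply: wG; exists (g q x).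
  have /boolp.choice[C CP] t : exists s, section_at x s /\ s x = c t.
    by have [s] := section_exists (c t); exists s.
  have [U xU Ux] := msection_exists u.
  have : \forall y \near x, z y ^+ j *: g q y =
      \sum_t C t y *: (z y ^+ j *: w t y) + z y ^+ j.+1 *: U y.
    apply: (@msection_eq_near _ _ E x (fun y => z y ^+ j *: g q y)
      (fun y => \sum_t C t y *: (z y ^+ j *: w t y) + z y ^+ j.+1 *: U y)).
    - by apply: msectionZ => //; exact: section_exp.
    - apply: msectionD.
        apply: (@msection_sum _ _ E x _ (fun t y => C t y *: (z y ^+ j *: w t y))) => t.
        apply: msectionZ; first exact: (CP t).1.
        by apply: msectionZ => //; exact: section_exp.
      by apply: msectionZ => //; exact: section_exp.
    - rewrite Ux -cu addrC; under [X in _ = _ + X]eq_bigr => t _ do rewrite (CP t).2.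
      by rewrite subrK.
  by apply: filterS => y yE; exists (fun t => C t y), (U y).
near=> y.
have Iy : I y = multiples (z y) 1 by near: y.
have [yg yG] : (forall i, msection_at y (g i)) /\
    forall v : E y, exists c : 'I_p -> stalk y, v = \sum_i c i *: g i y by near: y.
have [_ yR] : (forall q i, section_at y (R q i)) /\
     forall (c : 'I_r -> stalk y) (b : 'I_p -> stalk y),
       \sum_t c t *: (z y ^+ j *: w t y) = z y ^+ j.+1 *: \sum_q b q *: g q y <->
       exists d : 'I_l -> stalk y, (forall t, c t = \sum_q d q * R q (lshift p t) y) /\
         (forall t, - b t = \sum_q d q * R q (rshift r t) y) by near: y.
have yRI : forall q t, I y (R q (lshift p t) y) by near: y.
have yGg : forall q, exists (c : 'I_r -> stalk y) u,
    z y ^+ j *: g q y = \sum_t c t *: (z y ^+ j *: w t y) + z y ^+ j.+1 *: u by near: y.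
split=> [t|_ [v ->]|c [u cu] t]; first by exists (w t y).
  have /boolp.choice[C /boolp.choice[U CU]] := yGg.
  have [b ->] := yG v; exists (fun t => \sum_q b q * C q t); exists (\sum_q b q *: U q).
  rewrite !scaler_sumr; under eq_bigr => q _ do
    rewrite scalerA mulrC -scalerA CU scalerDr scaler_sumr.
  rewrite big_split /= exchange_big /= [X in X + _ - _](_ : _ =
    \sum_t (\sum_q b q * C q t) *: (z y ^+ j *: w t y)); last first.
    apply: eq_bigr => t _; rewrite scaler_suml.
    by apply: eq_bigr => q _; rewrite [LHS]scalerA.
  rewrite addrAC subrr add0r; apply: eq_bigr => q _.
  by rewrite !scalerA mulrC.
have [b ub] := yG u; rewrite ub in cu.
have /yR[d [dP _]] := cu; rewrite -Iy dP.
elim/big_ind: _ => [|a1 a2|q _]; first exact: (@submodule0 _ (stalk y)^o _ (ideal_atP I y)).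
  exact: (@submoduleD _ (stalk y)^o _ (ideal_atP I y)).
exact: (@submoduleZ _ (stalk y)^o _ (ideal_atP I y)).
Unshelve. all: by end_near. Qed.

End GradedLocallyFree.

Section GradedLocallyFreeOfQuasiFree.
Context (k : fieldType) (X : ringed_space k) (I : ideal_sheaf X) (E : module_sheaf X).

Lemma graded_piece_free_near (x : subscheme I) (z : forall y : X, stalk y) j r
    (w : 'I_r -> E (val x)) :
  coherent E -> section_at (val x) z ->
  (\forall y \near val x, I y = multiples (z y) 1) -> graded_basis (z (val x)) j w ->
  exists e : 'I_r -> forall y : subscheme I, gr_stalk E j y, \forall y \near x,
    (forall t, gr_section_at y (e t)) /\ gr_basis (fun t => e t y).
Proof.
move=> Ecoh xz Iz wB.
have /boolp.choice[W WP] t : exists s, msection_at (val x) s /\ s (val x) = w t.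
  by have [s] := msection_exists (w t); exists s.
exists (fun t y => gr_class (power_lift I j (z (val y)) (W t (val y)))).
have WB : graded_basis (z (val x)) j (fun t => W t (val x)).
  by rewrite (_ : (fun t => W t (val x)) = w) //; apply/funext => t; exact: (WP t).2.
have Wy := graded_basis_near xz Iz Ecoh (fun t => (WP t).1) WB.
have Wy' := near_support Wy; have Iy := near_support Iz.
have sec t : \forall y \near x,
    gr_section_at y (fun y => gr_class (power_lift I j (z (val y)) (W t (val y)))).
  have [H _ _] := @gr_etale _ _ I E j; apply: H.
  exists (fun y => z y ^+ j *: W t y).
    by apply: msectionZ; [exact: section_exp|exact: (WP t).1].
  near=> y; exists (power_lift I j (z (val y)) (W t (val y))) => //.
  have Iyy : I (val y) = multiples (z (val y)) 1 by near: y.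
  exact: (val_power_lift j Iyy).
have secs : \forall y \near x, forall t,
    gr_section_at y (fun y => gr_class (power_lift I j (z (val y)) (W t (val y)))).
  exact: (@filter_forall _ 'I_r (fun t => [set y | gr_section_at y
    (fun y => gr_class (power_lift I j (z (val y)) (W t (val y))))]) (nbhs x) _ sec).
near=> y; split; first by near: y.
have Iyy : I (val y) = multiples (z (val y)) 1 by near: y.
by apply/(gr_basis_graded_basis j Iyy); near: y.
Unshelve. all: by end_near. Qed.

(* Any open condition at the specialization [P] also holds near [x], so the ring-theoretic
   hypotheses are only needed at the points [P]. *)
Lemma graded_locally_free n : coherent E ->
  (forall x : X, exists2 P, forall V : set X, nbhs P V -> V x &
     ~ I P 1 /\ exists z, [/\ section_at P z, \forall y \near P, I y = multiples (z y) 1 &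
       forall j a, multiples (z P) j.+1 (a * z P ^+ j) -> z P ^+ j = 0 \/ I P a]) ->
  quasi_locally_free E I n ->
  forall j, (j < n)%N -> locally_free (graded_piece I E j).
Proof.
move=> Ecoh XP Eqlf j jn x.
have [P Px [I1 [z [zP Iz zD]]]] := XP (val x).
have [m /nbhs_singleton Pqf] := Eqlf P.
have [r [w wB]] := graded_basis_of_quasi_free (nbhs_singleton Iz) (zD j) jn Pqf.
pose P' : subscheme I := exist _ P (mem_set (I1 : Defs.support I P)).
have [e eP] := @graded_piece_free_near P' z j r w Ecoh zP Iz wB.
(* What holds near [P] holds near every point of some neighbourhood of [P], and any such
   neighbourhood contains [val x]. *)
exists r, e; have /near_join/near_subscheme/Px/(_ x erefl) := eP.
by [].
Qed.

End GradedLocallyFreeOfQuasiFree.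

(** * The local rings of a multiple curve *)

Section LocalAlgebra.
Context (A : comNzRingType).
Implicit Types (I J : set A) (a b c s t u x : A).

Definition nonzerodivisor s : Prop := forall x, s * x = 0 -> x = 0.

Lemma nonunitsM a b : nonunits b -> nonunits (a * b).
Proof.
move=> bN [c [abc _]]; have bac : b * (a * c) = 1 by rewrite mulrA [b * a]mulrC.
by apply: bN; exists (a * c); rewrite [_ * b]mulrC.
Qed.

Lemma ideal0 I : ideal I -> I 0. Proof. by move=> II; exact: (@submodule0 A A^o _ II). Qed.
Lemma idealD I a b : ideal I -> I a -> I b -> I (a + b).
Proof. by move=> II; exact: (@submoduleD A A^o _ II). Qed.
Lemma idealB I a b : ideal I -> I a -> I b -> I (a - b).
Proof. by move=> II; exact: (@submoduleB A A^o _ II). Qed.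
Lemma ideal_mull I a b : ideal I -> I b -> I (a * b).
Proof. by move=> II; exact: (@submoduleZ A A^o _ II). Qed.
Lemma ideal_mulr I a b : ideal I -> I a -> I (a * b).
Proof. by move=> II Ia; rewrite mulrC; exact: ideal_mull. Qed.

Lemma ideal_invertible I a b : ideal I -> invertible a -> I (a * b) -> I b.
Proof. by move=> II [c [_ ca]] /(ideal_mull c II); rewrite mulrA ca mul1r. Qed.

Lemma invertible1B a : local_ring A -> nonunits a -> invertible (1 - a).
Proof.
move=> Aloc aN; apply: contrapT => H; have := idealD Aloc H aN.
by rewrite subrK; apply; exists 1; rewrite mulr1.
Qed.

(** Some member of the chain contains the finitely many generators of the union. *)
Lemma noetherian_stationary (L : nat -> set A) :
  noetherian A -> (forall i, ideal (L i)) -> (forall i, L i `<=` L i.+1) ->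
  exists i, L i.+1 `<=` L i.
Proof.
move=> Anoeth LI LS.
have Lle i j : (i <= j)%N -> L i `<=` L j.
  by move/subnK <-; elim: (j - i)%N => // d IHd a /IHd; exact: LS.
pose U : set A := [set a | exists i, L i a].
have UI : ideal U.
  split=> [|a u v [i Lu] [j Lv]]; first by exists 0%N; exact: ideal0.
  exists (maxn i j); apply: (LI _).2.
    by apply: Lle Lu; exact: leq_maxl.
  by apply: Lle Lv; exact: leq_maxr.
have [s sE] := Anoeth U UI.
have [i iE] : exists i, {in s, forall a, L i a}.
  have : {in s, forall a, U a}.
    by move=> a sa; rewrite sE; exact: sub_gen_smallest.
  elim: s {sE} => [|a s IHs] sU; first by exists 0%N.
  have [j Lj] : U a by apply: sU; exact: mem_head.
  have [|i Li] := IHs; first by move=> b sb; apply: sU; rewrite inE sb orbT.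
  exists (maxn i j) => b; rewrite inE => /orP[/eqP->|sb].
    by apply: Lle Lj; exact: leq_maxr.
  by apply: Lle (Li b sb); exact: leq_maxl.
exists i => a La; have : U a by exists i.+1.
rewrite sE; apply: smallest_sub; [exact: LI|exact: iE].
Qed.

(* Krull's intersection theorem for the quotient by [J], whose maximal ideal is generated
   by [t]. *)
Lemma unit_times_power J t f :
  local_ring A -> noetherian A -> ideal J -> nonunits t ->
  (forall a, nonunits a -> exists b, J (a - b * t)) ->
  ~ J f -> exists u e, invertible u /\ J (f - u * t ^+ e).
Proof.
move=> Aloc Anoeth JI tN tG fJ; apply: contrapT => noform.
pose N : set A := [set f | forall e, exists g, J (f - g * t ^+ e)].
have Nf : N f.
  elim=> [|e [g gJ]]; first by exists f; rewrite mulr1 subrr; exact: ideal0.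
  have [|b bJ] := tG g; first by move=> gU; apply: noform; exists g, e.
  exists b; rewrite -(subrKA (g * t ^+ e)) exprS mulrA -mulrBl.
  by apply: idealD => //; exact: ideal_mulr.
(* The ideals of the [a] with [J (a * t ^+ i)] increase with [i]; where they stop, one factor [t]
   can be cancelled. *)
have [s sP] : exists s : nat, forall a, J (a * t ^+ s.+1) -> J (a * t ^+ s).
  have [|i|i a /= Ja|s sP] := @noetherian_stationary (fun i => [set a | J (a * t ^+ i)]).
  - exact: Anoeth.
  - split=> [|a u v Ju Jv] /=; first by rewrite mul0r; exact: ideal0.
    rewrite mulrDl -mulrA; apply: idealD => //; exact: ideal_mull.
  - by rewrite /= exprSr mulrA; exact: ideal_mulr.
  - by exists s.
(* If [h] is [g * t ^+ s.+1] modulo [J], then [g * t ^+ s] is still in [N] by cancellation, so [N]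
   is contained in [t N + J]. *)
have Ndiv h : exists h', N h -> N h' /\ J (h - t * h').
  have [Nh|] := pselect (N h); last by exists 0.
  have [g gJ] := Nh s.+1; exists (g * t ^+ s) => _; split; last first.
    by rewrite mulrCA -exprS.
  move=> e; have [g' gJ'] := Nh (e + s.+1)%N.
  exists (g' * t ^+ s); rewrite -mulrA -exprD addnC exprD mulrA -mulrBl.
  apply: sP; rewrite mulrBl -mulrA -exprD.
  have -> : g * t ^+ s.+1 - g' * t ^+ (e + s.+1) =
      (h - g' * t ^+ (e + s.+1)) - (h - g * t ^+ s.+1) by rewrite opprB [RHS]addrC subrKA.
  exact: idealB.
have {Ndiv} [next nextP] := boolp.choice Ndiv.
pose F i := iter i next f.
have NF i : N (F i) by elim: i => // i /nextP[].
have FJ i : J (F i - t * F i.+1) by have [] := nextP _ (NF i).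
have F0 i : J (F i) -> J f.
  elim: i => // i IHi Ji; apply: IHi; rewrite -(subrK (t * F i.+1) (F i)).
  by apply: idealD => //; exact: ideal_mull.
have [i|i a [b bJ]|i iP] :=
  @noetherian_stationary (fun i => [set a | exists b, J (a - b * F i)]) Anoeth.
- split=> [|a u v [b ub] [c vc]]; first by exists 0; rewrite mul0r subrr; exact: ideal0.
  exists (a * b + c); rewrite mulrDl opprD addrACA -mulrA -mulrBr.
  by apply: idealD => //; exact: ideal_mull.
- exists (b * t); rewrite -(subrKA (b * F i)) -mulrA -mulrBr.
  by apply: idealD => //; exact: ideal_mull.
have [|a aJ] := iP (F i.+1); first by exists 1; rewrite mul1r subrr; exact: ideal0.
apply: fJ; apply: (F0 i.+1).
apply: (@ideal_invertible J (1 - a * t)) => //.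
  by apply: invertible1B => //; exact: nonunitsM.
rewrite mulrBl mul1r -mulrA -(subrKA (a * F i)) -mulrBr.
by apply: idealD => //; apply: ideal_mull.
Qed.

Context (I : set A) (Aloc : local_ring A) (Anoeth : noetherian A) (II : ideal I).
Context (Irad : forall a e, I (a ^+ e) -> I a).
Context (t : A) (tN : nonunits t) (tI : ~ I t).
Context (tG : forall a, nonunits a -> exists b, I (a - b * t)).

Lemma proper_nonunits a : I a -> nonunits a.
Proof.
by move=> Ia [b [ab _]]; apply: tI; rewrite -[t]mul1r -ab; do 2!apply: ideal_mulr => //.
Qed.

(** Here [t] and [z = x2 - g * t] generate the maximal ideal, and [z] lies in [I]. An element of [I]
    outside [(z)] would be a unit times a power of [t] modulo [z], putting [t] in the radical ideal
    [I]. *)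
Let principal_aux x1 x2 a b :
  (forall c, nonunits c -> exists d e, c = d * x1 + e * x2) -> nonunits x2 ->
  t = a * x1 + b * x2 -> invertible a -> exists z, I = [set c | exists d, c = d * z].
Proof.
move=> xG x2N tE [a' [aa' a'a]].
have [g zI] := tG x2N; set z := x2 - g * t in zI.
have x1E : x1 = a' * (t - b * x2) by rewrite tE addrK mulrA a'a mul1r.
have zP : ideal [set c | exists d, c = d * z].
  split=> [|c u v [d ->] [e ->]]; first by exists 0; rewrite mul0r.
  by exists (c * d + e); rewrite mulrDl /GRing.scale /= mulrA.
exists z; apply/seteqP; split=> [f If|_ [d ->]]; last exact: ideal_mull.
apply: contrapT => fz.
have [c /xG[d [e ->]]|u [e [uU [d fE]]]] := unit_times_power Aloc Anoeth zP tN _ fz.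
  exists (d * a' + (e - d * a' * b) * g), (e - d * a' * b).
  by rewrite x1E /z; ring.
apply: tI; apply: (@Irad _ e); apply: (ideal_invertible II uU).
rewrite -[_ * _](subKr f) fE; apply: idealB => //; exact: ideal_mull.
Qed.

(* [t] is part of a system of two generators of the maximal ideal, since [t] lies neither in
   [I] nor, by Nakayama, in the square of the maximal ideal plus [I]; the other generator can
   be corrected by a multiple of [t] to lie in [I], and then it generates [I]. *)
Lemma principal_ideal x1 x2 : nonunits x1 -> nonunits x2 ->
  (forall c, nonunits c -> exists d e, c = d * x1 + e * x2) ->
  exists z, I = [set c | exists d, c = d * z].
Proof.
move=> x1N x2N xG; have [a [b tE]] := xG t tN.
have [aU|aN] := pselect (invertible a); first exact: principal_aux tE aU.
have [bU|bN] := pselect (invertible b).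
  apply: (@principal_aux x2 x1 b a) => // [c /xG[d [e ->]]|].
    by exists e, d; rewrite addrC.
  by rewrite addrC.
(* With [a] and [b] both nonunits, [t] is [(a' * x1 + b' * x2) * t] modulo [I], which forces [t]
   into [I]. *)
have [a' aI] := tG aN; have [b' bI] := tG bN; case: tI.
apply: (@ideal_invertible _ (1 - (a' * x1 + b' * x2))) => //.
  by apply: invertible1B => //; apply: idealD => //; exact: nonunitsM.
have -> : (1 - (a' * x1 + b' * x2)) * t = (a - a' * t) * x1 + (b - b' * t) * x2.
  by rewrite mulrBl mul1r {1}tE; ring.
by apply: idealD => //; apply: ideal_mulr.
Qed.

(** If [s + a] kills [x], then [s ^+ l * x = (- a) ^+ l * x] for all [l], which is 0 at [l = e]. *)
Lemma nonzerodivisor_add_nilpotent s a e : nonzerodivisor s -> a ^+ e = 0 ->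
  nonzerodivisor (s + a).
Proof.
move=> sD ae x; rewrite mulrDl => /eqP; rewrite addr_eq0 -mulNr => /eqP sx.
have sX l : s ^+ l * x = (- a) ^+ l * x.
  elim: l => [|l IHl]; first by rewrite !mul1r.
  by rewrite exprSr -mulrA sx mulrCA IHl exprS mulrA.
have : s ^+ e * x = 0 by rewrite sX exprNn ae mulr0 mul0r.
by elim: e {ae} => [|e IHe]; rewrite ?mul1r // exprS -mulrA => /sD.
Qed.

(** Up to elements of [I], which are nilpotent, [s] and [a] are units times powers of [t]. So [s]
    shows that [t] is a nonzerodivisor, and [t] that [a] is one. *)
Lemma nonzerodivisor_outside s : (forall a, I a -> exists e, a ^+ e = 0) ->
  nonunits s -> nonzerodivisor s -> forall a, ~ I a -> nonzerodivisor a.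
Proof.
move=> Inil sN sD.
have sI : ~ I s.
  move=> /Inil[e]; elim: e => [|e IHe]; first by move/eqP; rewrite oner_eq0.
  by rewrite exprS => /sD.
have powD b u e : invertible u -> I (b - u * t ^+ e) -> nonzerodivisor b ->
    nonzerodivisor (u * t ^+ e).
  move=> uU Ib bD; have [l lE] := Inil _ Ib.
  rewrite -[_ * _](subKr b); apply: (@nonzerodivisor_add_nilpotent _ _ l) => //.
  by rewrite exprNn lE mulr0.
have tD : nonzerodivisor t.
  have [u [e [uU sE]]] := unit_times_power Aloc Anoeth II tN tG sI.
  (* The exponent is positive: for [e = 0] the unit [u] would be the nonunit [s] minus an element of
     [I]. *)
  have := powD _ _ _ uU sE sD; case: e sE => [|e] sE uD x tx.
    suff uN : nonunits u by case: uN.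
    rewrite -[u]mulr1 -[_ * _](subKr s).
    by apply: idealB => //; exact: proper_nonunits.
  by apply: uD; rewrite exprSr !mulrA -mulrA tx mulr0.
move=> a aI; have [u [e [[v [uv vu]] aE]]] := unit_times_power Aloc Anoeth II tN tG aI.
have [l lE] := Inil _ aE; rewrite -(subrK (u * t ^+ e) a) addrC.
apply: (@nonzerodivisor_add_nilpotent _ _ l) => // x.
rewrite -mulrA => ux; have {ux} : t ^+ e * x = 0.
  by rewrite -[LHS]mul1r -vu -[LHS]mulrA ux mulr0.
by elim: e {aE lE} => [|e IHe]; rewrite ?mul1r // exprS -mulrA => /tD.
Qed.

End LocalAlgebra.

(** * Quotients of the ambient local ring *)

Section QuotientRings.
Context (k : fieldType) (O : comAlgType k).
Implicit Types (J : properIdeal O) (x y : O).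

Lemma qr_class_surj J (q : quoring J) : exists x, qr_class J x = q.
Proof. by exists (qr_repr q); exact: qr_reprK. Qed.

Lemma qr_classMn J x y : qr_class J (x * y) = qr_class J x * qr_class J y.
Proof. exact: qr_classM. Qed.

Lemma qr_class1 J : qr_class J 1 = 1. Proof. by []. Qed.

Lemma qr_classX J x e : qr_class J (x ^+ e) = qr_class J x ^+ e.
Proof. by elim: e => // e IHe; rewrite !exprS qr_classMn IHe. Qed.

Lemma qr_classB J x y : qr_class J (x - y) = qr_class J x - qr_class J y.
Proof. by rewrite /qr_class raddfB. Qed.

Lemma qr_class0 J : qr_class J 0 = 0. Proof. by rewrite /qr_class raddf0. Qed.

Lemma qr_class_eq0 J x : qr_class J x = 0 <-> J x.
Proof. by rewrite -[X in J X]subr0 -qr_classP qr_class0. Qed.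

Lemma invertible_qr_class J x : invertible (qr_class J x) <-> exists y, J (x * y - 1).
Proof.
split=> [[q [xq _]]|[y xy]].
  have [y yq] := qr_class_surj q; exists y; apply/qr_classP.
  by rewrite qr_classMn yq xq.
by exists (qr_class J y); rewrite [_ * qr_class J x]mulrC -qr_classMn; split; apply/qr_classP.
Qed.

(** If [x * y - 1] is in [J'], its class modulo [J] is a nonunit, as [J'] is proper; by locality,
    [x] is then a unit modulo [J]. *)
Lemma nonunits_qr_class J J' x : J `<=` J' -> local_ring (quoring J) ->
  nonunits (qr_class J x) <-> nonunits (qr_class J' x).
Proof.
move=> JJ' Jloc; split=> xN; last first.
  by move=> /invertible_qr_class[y xy]; apply/xN/invertible_qr_class; exists y; exact: JJ'.
move=> /invertible_qr_class[y xy].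
have xyN : nonunits (qr_class J (x * y - 1)).
  move=> /invertible_qr_class[w ww]; apply: (proper_not1 (p := J')).
  have J'I := proper_is_ideal J'.
  rewrite -[1](subKr ((x * y - 1) * w)); apply: idealB => //; last exact: JJ'.
  exact: ideal_mulr.
have : nonunits (qr_class J (x * y) - qr_class J (x * y - 1)).
  apply: idealB => //; rewrite qr_classMn mulrC; exact: nonunitsM.
by rewrite -qr_classB subKr qr_class1; apply; exists 1; rewrite mulr1.
Qed.

(** This is the canonical projection once [J] is contained in [J']. *)
Definition qr_map J J' (q : quoring J) : quoring J' := qr_class J' (qr_repr q).

Lemma qr_map_class J J' x : J `<=` J' -> qr_map J' (qr_class J x) = qr_class J' x.
Proof. by move=> JJ'; apply/qr_classP/JJ'/qr_repr_class. Qed.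

Lemma prime_ideal_preimage J J' (p : set (quoring J')) : J `<=` J' ->
  prime_ideal p -> prime_ideal (@qr_map J J' @^-1` p).
Proof.
move=> JJ' [pI p1 pM]; split.
- split=> [|q u v] /=.
    by rewrite -(qr_class0 J) qr_map_class // qr_class0; exact: ideal0.
  have [a <-] := qr_class_surj q; have [x <-] := qr_class_surj u.
  have [y <-] := qr_class_surj v.
  rewrite !qr_map_class // => px py.
  rewrite (_ : qr_class J a *: (qr_class J x : (quoring J)^o) + qr_class J y =
    qr_class J (a * x + y)); last by rewrite qr_classD qr_classMn.
  rewrite qr_map_class // qr_classD qr_classMn; apply: idealD => //; exact: ideal_mull.
- by rewrite /= -qr_class1 qr_map_class // qr_class1.
- move=> u v; have [x <-] := qr_class_surj u; have [y <-] := qr_class_surj v.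
  rewrite /= -qr_classMn !qr_map_class // qr_classMn; exact: pM.
Qed.

Lemma ideal_span_seq1 (A : comNzRingType) (a c : A) :
  ideal_span [set` [:: a]] c -> exists d, c = d * a.
Proof.
move=> /(_ [set c | exists d, c = d * a]); apply; split.
  split=> [|e u v [d ->] [f ->]]; first by exists 0; rewrite mul0r.
  by exists (e * d + f); rewrite mulrDl /GRing.scale /= mulrA.
by move=> b /=; rewrite inE => /eqP ->; exists 1; rewrite mul1r.
Qed.

Lemma ideal_span_seq2 (A : comNzRingType) (a b c : A) :
  ideal_span [set` [:: a; b]] c -> exists d e, c = d * a + e * b.
Proof.
move=> /(_ [set c | exists d e, c = d * a + e * b]); apply; split.
  split=> [|x u v [d [e ->]] [f [g ->]]]; first by exists 0, 0; rewrite !mul0r addr0.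
  by exists (x * d + f), (x * e + g); rewrite /GRing.scale /=; ring.
move=> x /=; rewrite !inE => /orP[]/eqP ->; first by exists 1, 0; rewrite mul1r mul0r addr0.
by exists 0, 1; rewrite mul1r mul0r add0r.
Qed.

Context (S Y C : properIdeal O) (SY : S `<=` Y).
Context (Yrad : (C : set O) = radical (Y : set O)).
Context (C_regular : regular_local (quoring C) 1) (S_regular : regular_local (quoring S) 2).
Context (Y_CM : cohen_macaulay_local (quoring Y)).

Let YC : Y `<=` C.
Proof. by move=> x Yx; rewrite Yrad; exists 1%N. Qed.

Let I : set (quoring Y) := [set qr_class Y a | a in (C : set O)].

Let I_class x : I (qr_class Y x) <-> C x.
Proof.
split=> [[a Ca /qr_classP ax]|Cx]; last by exists x.
rewrite -(subKr a x); apply: idealB => //; first exact: proper_is_ideal.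
exact: YC.
Qed.

(** In the ambient local ring [O], the ideals [S], [Y] and [C] are those of the surface, the
    multiple curve and its support. *)
Lemma multiple_curve_local : exists2 z : quoring Y, I = multiples z 1 &
  forall j a, multiples z j.+1 (a * z ^+ j) -> z ^+ j = 0 \/ I a.
Proof.
have [Yloc Ynoeth [d [s [[Ydim Ydim'] sN [_ sreg]]]]] := Y_CM.
have [_ _ [[p [pP pS]] _] [t' t'E]] := C_regular.
have [Sloc _ _ [x' x'E]] := S_regular.
have SC : S `<=` C by move=> x /SY/YC.
have II : ideal I.
  split=> [|a u v]; first by rewrite -(qr_class0 Y) I_class; exact: ideal0 (proper_is_ideal C).
  have [x <-] := qr_class_surj a; have [y <-] := qr_class_surj u.
  have [w <-] := qr_class_surj v; move=> /I_class Cy /I_class Cw.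
  rewrite (_ : qr_class Y x *: (qr_class Y y : (quoring Y)^o) + qr_class Y w =
    qr_class Y (x * y + w)); last by rewrite qr_classD qr_classMn.
  have CI := proper_is_ideal C.
  by rewrite I_class; apply: idealD => //; exact: ideal_mull.
have Irad a e : I (a ^+ e) -> I a.
  have [x <-] := qr_class_surj a; rewrite -qr_classX !I_class Yrad => -[m Ym].
  by exists (e * m)%N; rewrite exprM.
have Inil a : I a -> exists e, a ^+ e = 0.
  have [x <-] := qr_class_surj a; rewrite I_class Yrad => -[m Ym].
  by exists m; rewrite -qr_classX; apply/qr_class_eq0.
have NC x : nonunits (qr_class C x) <-> nonunits (qr_class Y x).
  by rewrite (nonunits_qr_class x YC).
have [t0 tN tG] : exists2 t, nonunits t & forall a, nonunits a -> exists b, I (a - b * t).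
  have [t tt] := qr_class_surj (tnth t' ord0).
  have t'1 : (t' : seq _) = [:: qr_class C t].
    by case: t' tt {t'E} => [[|u [|]]] //= Hu; rewrite (tnth_nth 0) => ->.
  have {}t'E : @nonunits (quoring C) = ideal_span [set` tval t'] by exact: t'E.
  rewrite t'1 in t'E; exists (qr_class Y t).
    by apply/NC; rewrite t'E; apply: sub_gen_smallest; rewrite /= mem_head.
  move=> a; have [x <-] := qr_class_surj a; move=> /NC; rewrite t'E => /ideal_span_seq1.
  move=> [e eE]; have [b bE] := qr_class_surj e; exists (qr_class Y b).
  rewrite -qr_classMn -qr_classB I_class; apply/qr_class_eq0.
  by rewrite qr_classB qr_classMn bE -eE subrr.
have [x1 [x2 [x1N x2N xG]]] : exists x1 x2 : quoring Y, [/\ nonunits x1, nonunits x2 &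
    forall a, nonunits a -> exists b c, a = b * x1 + c * x2].
  have [u uu] := qr_class_surj (tnth x' ord0).
  have [v vv] := qr_class_surj (tnth x' (lift ord0 ord0)).
  have x'1 : (x' : seq _) = [:: qr_class S u; qr_class S v].
    case: x' uu vv {x'E} => [[|a [|b [|]]]] //= Hu.
    by rewrite !(tnth_nth 0) /= => -> ->.
  have NS x : nonunits (qr_class S x) <-> nonunits (qr_class Y x).
    exact: nonunits_qr_class.
  have {}x'E : @nonunits (quoring S) = ideal_span [set` tval x'] by exact: x'E.
  rewrite x'1 in x'E; exists (qr_class Y u), (qr_class Y v); split.
  - by apply/NS; rewrite x'E; apply: sub_gen_smallest; rewrite /= !inE eqxx.
  - by apply/NS; rewrite x'E; apply: sub_gen_smallest; rewrite /= !inE eqxx orbT.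
  - move=> a; have [x <-] := qr_class_surj a; move=> /NS; rewrite x'E => /ideal_span_seq2.
    move=> [d1 [d2 xE]]; have [b bE] := qr_class_surj d1; have [c cE] := qr_class_surj d2.
    exists (qr_class Y b), (qr_class Y c); rewrite -!qr_classMn -qr_classD.
    apply/qr_classP/SY/qr_classP; rewrite qr_classD !qr_classMn bE cE; exact: xE.
(* Otherwise the maximal ideal of [quoring C] would be zero, against its strict chain of two
   primes. *)
have t0I : ~ I t0.
  move=> It; have [_ /existsNP[a /not_implyP[p1a p0a]]] := pS 0%N isT.
  have [x xa] := qr_class_surj a.
  have : nonunits a.
    move=> [b [_ ba]]; have [p1I p11 _] := pP 1%N isT; apply: p11.
    by rewrite -ba; exact: ideal_mull.
  rewrite -xa => /NC/tG[b bI]; apply: p0a.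
  have [p0I _ _] := pP 0%N isT; rewrite -xa (qr_class_eq0 C x).2; first exact: ideal0.
  apply/I_class; rewrite -(subrK (b * t0) (qr_class Y x)).
  by apply: idealD => //; exact: ideal_mull.
have [z0 z0E] := principal_ideal Yloc Ynoeth II Irad tN t0I tG x1N x2N xG.
exists z0; first by rewrite z0E; apply/seteqP; split=> a [b ->]; exists b; rewrite expr1.
(* The chain of two primes of [quoring C] pulls back to [quoring Y], so its dimension is not 0 and
   the regular sequence has a first element. *)
have d_gt0 : (0 < d)%N.
  case: d s Ydim Ydim' {sN sreg} => // _ _ [].
  exists (fun i => @qr_map Y C @^-1` p i); split=> [i /pP|i /pS[sub /existsNP[a /not_implyP[pa pa']]]].
    exact: prime_ideal_preimage.
  split; first by move=> q; exact: sub.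
  move=> H; apply: pa'; have [x xa] := qr_class_surj a.
  by rewrite -xa -(qr_map_class _ YC); apply: H; rewrite /= qr_map_class // xa.
have [s0 s0N s0D] : exists2 s0 : quoring Y, nonunits s0 & nonzerodivisor s0.
  exists (s`_0); first by apply/set_mem/sN; rewrite mem_nth ?size_tuple.
  move=> a sa; have := sreg 0%N _ a; rewrite size_tuple take0 sa => /(_ d_gt0).
  have span0 (c : quoring Y) : ideal_span [set` [::]] c -> c = 0.
    move=> /(_ [set 0]); apply; split=> //.
    by split=> // e u v -> ->; rewrite scaler0 addr0.
  move=> H; apply: span0; apply: H; exact: (span_submodule _).1.
have aD := nonzerodivisor_outside Yloc Ynoeth II tN t0I tG Inil s0N s0D.
(* If [a] is outside [I], so is [a - b * z0]; it is then a nonzerodivisor, and it kills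
   [z0 ^+ j]. *)
move=> j a [b abz]; have [|aI] := pselect (I a); first by right.
left; apply: (aD (a - b * z0)).
  move=> H; apply: aI; rewrite -(subrK (b * z0) a); apply: idealD => //.
  by rewrite z0E; exists b.
by rewrite mulrBl abz exprS mulrA subrr.
Qed.

End QuotientRings.

(** * Closed points *)

Lemma invertible_near (k : fieldType) (X : ringed_space k) (x : X)
    (s : forall y : X, stalk y) :
  section_at x s -> invertible (s x) -> \forall y \near x, invertible (s y).
Proof.
move=> xs [b [sb _]]; have [t xt tx] := section_exists b.
have : \forall y \near x, s y * t y = 1.
  apply: (@msection_eq_near _ _ (structure_sheaf X) x (fun y => s y * t y) (fun=> 1)).
  - exact: sectionM.
  - have := sectionC x 1; congr section_at.
    by apply: functional_extensionality_dep => y; rewrite scale1r.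
  - by rewrite tx.
by apply: filterS => y st; exists (t y); rewrite [t y * _]mulrC st.
Qed.

Definition specializes (T : topologicalType) (x P : T) : Prop :=
  forall V : set T, nbhs P V -> V x.

(* Schemes are T0. *)
Lemma specializes_antisym (k : fieldType) (X : ringed_space k) :
  finite_type_scheme X -> forall x y : X, specializes x y -> specializes y x -> x = y.
Proof.
move=> [_ charts] x y xy yx; have [A [U [phi [Ux _ chart]]]] := charts x.
have Uy : U y by apply: yx; apply: open_nbhs_nbhs; split=> //; exact: chart_open chart.
have inv (v w : X) a : U w -> specializes v w -> invertible (phi w a) -> invertible (phi v a).
  move=> Uw vw wa; apply: (vw (fun y => invertible (phi y a))).
  apply: (@invertible_near _ _ w (phi^~ a)) => //; exact: (chart_section chart).
have [z [_ zU]] := chart_point chart (chart_prime chart Ux).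
rewrite -(zU x) // (zU y) //; split=> //; apply/seteqP; split=> a /= aN.
  by move/(inv _ _ _ Uy xy).
by move/(inv _ _ _ Ux yx).
Qed.

(** Zorn's lemma gives a maximal open [U] not containing the closure of [x], compactness handling
    unions of chains. The points of the closure outside [U] specialize to each other, hence
    coincide. *)
Lemma closed_specialization (k : fieldType) (X : ringed_space k) :
  finite_type_scheme X -> forall x : X, exists2 P : X, closed_point P & specializes x P.
Proof.
move=> Xft x; have [Xcomp _] := Xft.
pose K := closure [set x].
have KE (y : X) : K y <-> specializes x y.
  split=> [Ky V /Ky[_ [-> //]]|xy V Vy]; by exists x; split=> //; exact: xy.
pose good (U : set X) := open U /\ exists2 y, K y & ~ U y.
have [|U [[oU [P KP nUP]] Umax]] := @Zorn_bigcup X good.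
  move=> F Fgood Ftot; split; first by apply: bigcup_open => V /Fgood[].
  (* [set0] is added so that the empty chain also yields a proper filter. *)
  pose D := [set U | F U \/ U = set0].
  pose G := filter_from D (fun U => K `\` U).
  have GP : ProperFilter G.
    apply: filter_from_proper; last first.
      move=> U [/Fgood[_ [y Ky nUy]]|->]; first by exists y.
      by exists x; split=> //; apply/KE => V; exact: nbhs_singleton.
    apply: filter_from_filter; first by exists set0; right.
    move=> U V DU DV; have [UV|VU] : U `<=` V \/ V `<=` U.
      case: DU => [FU|->]; last by left.
      case: DV => [FV|->]; last by right.
      exact: Ftot.
    - by exists V => // y [Ky nVy]; split; split=> // /UV.
    - by exists U => // y [Ky nUy]; split; split=> // /VU.
  (* A cluster point lies in the closed set [K] and outside every open member of the chain. *)
  have [p [_ pG]] := Xcomp G GP filterT.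
  exists p.
    apply/KE => V; rewrite nbhsE => -[W [oW Wp] WV].
    have Wnbhs (y : X) : W y -> nbhs y W by move=> Wy; exact: open_nbhs_nbhs.
    have [||y [[/KE yx _] /Wnbhs/yx/WV //]] := pG (K `\` set0) W; last exact: Wnbhs.
    by exists set0 => //; right.
  move=> [U FU Up]; have [||y [[_ nUy] Uy]] := pG (K `\` U) U.
  - by exists U => //; left.
  - by apply: open_nbhs_nbhs; split=> //; have [] := Fgood U FU.
  - exact: nUy.
(* If [q] did not specialize to [r], adding to [U] the complement of the closure of [q] would give a
   strictly larger open set still missing [q]. *)
have Kmin (q : X) : K q -> ~ U q -> forall r, K r -> ~ U r -> specializes q r.
  move=> Kq nUq r Kr nUr V rV; apply: contrapT => nVq.
  apply: (Umax (U `|` ~` closure [set q])).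
    split=> [y Uy|]; first by left.
    move=> /(_ r) H; apply: nUr; apply: H; right => /(_ V rV)[_ [-> //]].
  split; first by apply: openU => //; apply: closed_openC; exact: closed_closure.
  exists q => //; case=> // ; apply; exact: subset_closure.
exists P; last by apply/KE.
suff PE : [set P] = K `&` ~` U.
  by rewrite /closed_point PE; apply: closedI; [exact: closed_closure|exact: open_closedC].
apply/seteqP; split=> [_ -> //|y [Ky nUy]].
by apply: (specializes_antisym Xft); exact: Kmin.
Qed.

(** * Primitive multiple curves *)

Section MultipleCurve.
Context (k : fieldType) (X : ringed_space k) (C Y : closed_subscheme X).

Lemma ideal_in_class (y : subscheme Y) (a : stalk (val y)) :
  Y (val y) `<=` C (val y) -> ideal_in Y C y (sub_class a) <-> C (val y) a.
Proof.
move=> YC; split=> [[b Cb /sub_classP ba]|Ca]; last by exists a.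
rewrite -(subKr b a); apply: idealB => //; first exact: ideal_atP.
exact: YC.
Qed.

(** The ideal of [C] is generated near [P] by finitely many sections; each is a multiple of [z] at
    [P], hence near [P]. *)
Lemma ideal_in_principal_near (P : subscheme Y) (z : forall y : subscheme Y, stalk y) :
  section_at P z -> ideal_in Y C P = multiples (z P) 1 ->
  \forall y \near P, ideal_in Y C y = multiples (z y) 1.
Proof.
move=> zP zE; have [m [s sP]] := closed_ideal_coherent C (val P).
have [Ps Cs] := nbhs_singleton sP.
pose s' i (y : subscheme Y) := sub_class (s i (val y)) : stalk y.
have Ps' i : section_at P (s' i) by exists (s i); [exact: Ps|near=> y].
have near_s i : \forall y \near P, multiples (z y) 1 (s' i y).
  have : ideal_in Y C P (s' i P).
    by exists (s i (val P)) => //; rewrite Cs; apply: sub_gen_smallest; exists i.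
  rewrite zE => -[c cE]; have [c' Pc cc] := section_exists c.
  have : \forall y \near P, s' i y = c' y * z y ^+ 1.
    apply: (@msection_eq_near _ _ (structure_sheaf (subscheme Y)) P (s' i)
      (fun y => c' y * z y ^+ 1)) => //; last by rewrite cc.
      exact: Ps'.
    exact: (sectionM Pc (section_exp 1 zP)).
  by apply: filterS => y ->; exists (c' y).
have all_s : \forall y \near P, forall i, multiples (z y) 1 (s' i y).
  exact: (@filter_forall _ 'I_m (fun i => [set y | multiples (z y) 1 (s' i y)]) (nbhs P)).
have near_z : \forall y \near P, ideal_in Y C y (z y).
  by apply: ideal_open => //; rewrite zE; exists 1; rewrite mul1r.
have sP' := near_support sP.
near=> y; apply/seteqP; split=> [_ [a Ca <-]|_ [b ->]]; last first.
  rewrite expr1; apply: ideal_mull; first exact: ideal_atP.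
  by near: y.
have [_ CE] : (forall i, section_at (val y) (s i)) /\
  C (val y) = ideal_span [set s i (val y) | i in setT] by near: y.
have ys : forall i, multiples (z y) 1 (s' i y) by near: y.
move: a Ca; rewrite CE; apply: smallest_sub => [|_ [i _ <-]]; last exact: ys.
have mI := multiples_ideal (z y) 1.
split=> [|a u v mu mv] /=; first by rewrite /sub_class (qr_class0 _); exact: ideal0.
rewrite /sub_class qr_classD qr_classMn.
by apply: idealD => //; exact: ideal_mull.
Unshelve. all: by end_near. Qed.

Context (n : nat) (hY : primitive_multiple_curve C Y n).

Lemma curve_ideal_sub (x : X) : Y x `<=` C x.
Proof. by move=> a Ya; rewrite (pmc_reduced hY); exists 1%N. Qed.

Lemma curve_ideal_proper (x : X) : ~ Y x 1 -> ~ C x 1.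
Proof. by move=> Y1; rewrite (pmc_reduced hY) => -[m]; rewrite expr1n. Qed.

Lemma curve_closed_specialization (y : subscheme Y) :
  exists2 P : subscheme Y, closed_point (val P) & specializes y P.
Proof.
have [Xft _ _ _] := pmc_ambient hY.
have [P Pclosed yP] := closed_specialization Xft (val y).
(* If [Y] were the unit ideal at [P], it would be so near [P], hence at [val y]. *)
have P1 : ~ Y P 1.
  move=> YP; apply: (set_mem (valP y)).
  have := @ideal_open _ _ Y P _ (sectionC P 1); rewrite scale1r => /(_ YP).
  by move/yP; rewrite scale1r.
exists (exist _ P (mem_set (P1 : Defs.support Y P))) => // V /near_subscheme/yP.
by apply.
Qed.

Lemma curve_local (P : subscheme Y) : closed_point (val P) ->
  exists2 z, ideal_in Y C P = multiples z 1 &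
    forall j a, multiples z j.+1 (a * z ^+ j) -> z ^+ j = 0 \/ ideal_in Y C P a.
Proof.
move=> Pclosed; have Y1 := set_mem (valP P); have C1 := curve_ideal_proper Y1.
pose Q : subscheme C := exist _ (val P) (mem_set (C1 : Defs.support C (val P))).
have Qclosed : closed_point Q.
  rewrite /closed_point (_ : [set Q] = (val : subscheme C -> X) @^-1` [set val P]).
    by apply: closed_comp => // x _; exact: initial_continuous.
  by apply/seteqP; split=> [_ -> //|x xP]; exact: val_inj.
have [_ _ [_ Cregular]] := pmc_support hY.
have [S [_ _ [p pP Sregular] SY]] := pmc_surface hY Pclosed C1.
have SPY := nbhs_singleton SY.
have S1 : ~ S (val P) 1 by move/SPY.
pose p' : subscheme S := exist _ (val P) (mem_set (S1 : Defs.support S (val P))).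
have pp' : p = p' by apply: val_inj.
apply: (@multiple_curve_local k (stalk (val P)) (support_ideal p') (support_ideal P)
  (support_ideal Q)).
- exact: SPY.
- exact: pmc_reduced hY _.
- exact: (Cregular Q Qclosed).
- by rewrite pp' in Sregular.
- exact: pmc_cohen_macaulay hY P.
Qed.

Lemma curve_section (P : subscheme Y) : closed_point (val P) ->
  exists z : forall y : subscheme Y, stalk y, [/\ section_at P z,
    \forall y \near P, ideal_in Y C y = multiples (z y) 1 &
    forall j a, multiples (z P) j.+1 (a * z P ^+ j) ->
      z P ^+ j = 0 \/ ideal_in Y C P a].
Proof.
move=> /curve_local[z0 zE zD]; have [z zP zz0] := section_exists z0.
rewrite -{}zz0 in zE zD; exists z; split=> //; exact: ideal_in_principal_near.
Qed.

Lemma ideal_in_proper (y : subscheme Y) : ~ ideal_in Y C y 1.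
Proof.
move=> /(ideal_in_class 1 (@curve_ideal_sub _)); apply: curve_ideal_proper.
exact: set_mem (valP y).
Qed.

Lemma ideal_in_nilpotent (y : subscheme Y) (z : stalk y) : ideal_in Y C y z -> z ^+ n = 0.
Proof.
move=> [a Ca <-]; rewrite /sub_class -qr_classX; apply/qr_class_eq0.
have [CnY _] := pmc_multiplicity hY; apply: CnY.
elim: n => [//|e IHe]; rewrite exprS.
by apply: sub_gen_smallest; exists a => //; exists (a ^+ e).
Qed.

End MultipleCurve.

Theorem mainTheorem6 (R : realType) (X : ringed_space R[i]) (C Y : closed_subscheme X)
    (n : nat) (hn : (1 < n)%N) (hY : primitive_multiple_curve C Y n)
    (hproj : projective (subscheme Y)) (E : module_sheaf (subscheme Y))
    (hE : coherent E) :
  quasi_locally_free E (ideal_in Y C) n <->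
  (forall i : nat, (1 <= i <= n)%N ->
     locally_free (graded_piece (ideal_in Y C) E i.-1)).
Proof.
split=> [Eqlf [//|j] /= jn|gr_free].
  apply: (graded_locally_free hE _ Eqlf jn) => y.
  have [P Pclosed yP] := curve_closed_specialization hY y.
  exists P => //; split; first exact: ideal_in_proper hY P.
  exact: curve_section hY _ Pclosed.
apply: quasi_locally_free_of_graded => [y|j jn]; last exact: (gr_free j.+1).
split; first by have [] := pmc_cohen_macaulay hY y.
  exact: ideal_in_proper hY y.
have [P Pclosed yP] := curve_closed_specialization hY y.
(* A generator near a closed specialization of [y] also generates the ideal at [y]. *)
have [z [_ zE _]] := curve_section hY Pclosed; have Iz := yP _ zE.
exists (z y) => //; apply: (ideal_in_nilpotent hY).
by rewrite Iz; exists 1; rewrite mul1r.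
Qed.
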